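(* Let $0<a\le 1$, $a+b=1$, and let $F(v)=a(v_1^2+v_2^2)^{1/2}+b(v_1^4+v_2^4)^{1/4}$ on $\mathbb{R}^2$. Let $Q(L,\alpha,\alpha)$ be the symmetric Minkowski billiard table on $(\mathbb{R}^2,F)$ described in the context, let $R>0$ be the common Euclidean radius of curvature of its two curved boundary parts at the vertices $(0,0)$ and $(L,0)$, and let $R''$ be the second derivative at $s=0$ of the radius of curvature function $R(s)$. Suppose $L\in(0,2aR)\setminus\{aR\}$ (equivalently, $P$ is elliptic and the eigenvalue $\lambda$ of the tangent map of the one-step billiard map at $P$ satisfies $\lambda^4\ne1$). Then the first twist coefficient of the one-step billiard map $\mathcal{T}:(s,u)\mapsto(s_1,u_1)$ at the elliptic periodic point $P$ is $$\tau_1(\mathcal{T},P)=\frac{a^2LRR''+(4-3a)aL+2(2a-9)aR+12R}{8a^2R(L-2aR)}.$$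
   Context: Table. Let $\alpha(t)=\sum_{n\ge1}\alpha_{2n}t^{2n}$ be an even function (an even polynomial) on $(-\epsilon,\epsilon)$ for some $\epsilon>0$, with $\alpha_2>0$, and let $L>0$. The boundary of $Q(L,\alpha,\alpha)$ consists of the curves $\gamma_0:t\mapsto(\alpha(t),t)$ and $\gamma_1:t\mapsto(L-\alpha(t),-t)$, $t\in(-\epsilon,\epsilon)$, together with two horizontal segments joining their endpoints. Each $\gamma_j$ is parametrized (counterclockwise around the table) by local $F$-arc-length $s$, so $F(\gamma_j'(s))=1$, with $s=0$ at the vertex: $\gamma_0(0)=(0,0)$, $\gamma_1(0)=(L,0)$, $\gamma_0'(0)=(0,-1)$, $\gamma_1'(0)=(0,1)$. $R(s)$ is the Euclidean radius of curvature at $\gamma_j(s)$ (the same function for $j=0,1$); $R=R(0)$ and $R''=R''(0)$, so $R=1/(2\alpha_2)$. Billiard map. A particle moves along straight lines inside the table; a ray $y_0x$ is reflected at $x\in\partial Q$ to the ray $xy_1$ iff $x$ is a critical point on $\partial Q$ of $x\mapsto F(x-y_0)+F(y_1-x)$. For $\ell(s,s_1)$ equal to the $F$-distance from the boundary point with parameter $s$ to the boundary point with parameter $s_1$ (i.e. $F$ of the latter minus the former), the phase point at parameter $s$ directed to the boundary point with parameter $s_1$ has coordinates $(s,u)$, $u=\frac{\partial\ell}{\partial s}(s,s_1)$. The billiard map sends $(s,u)$ to $(s_1,u_1)$, where $u_1=\frac{\partial\ell}{\partial s}(s_1,s_2)$ and $s_2$ is the parameter of the next impact; it preserves $ds\wedge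 du$. The orbit bouncing between $(0,0)$ and $(L,0)$ has period 2, and $P$ denotes its phase point at $(0,0)$, with coordinates $(s,u)=(0,0)$. Since $F(-v)=F(v)$ and the table is invariant under the rotation $\mathrm{Rot}_\pi$ by $\pi$ about $(L/2,0)$, the phase space over $\gamma_1$ is identified with the phase space over $\gamma_0$ via $\mathrm{Rot}_\pi$. The one-step billiard map $\mathcal{T}$ is the self-map (billiard map from $\gamma_0$ to $\gamma_1$ followed by $\mathrm{Rot}_\pi$) near $P$; it fixes $P=(0,0)$. Twist coefficient. Let $f$ be a smooth local diffeomorphism preserving $ds\wedge du$ with fixed point $P=(0,0)$ that is elliptic (the eigenvalues of $D_Pf$ satisfy $|\lambda|=1$, $\lambda\ne\pm1$) and satisfies $\lambda^4\neq1$. Then there are local real coordinates $(X,Y)$ centered at $P$ with $dX\wedge dY=ds\wedge du$ in which $$f\begin{bmatrix} X \\ Y \end{bmatrix}=\begin{bmatrix} \cos\Theta & -\sin\Theta \\ \sin\Theta & \cos\Theta \end{bmatrix}\begin{bmatrix} X \\ Y \end{bmatrix}+(\text{terms of order}\ge4),\qquad\Theta=\theta+\tau_1(X^2+Y^2),$$ for some constants $\theta,\tau_1$; the number $\tau_1=\tau_1(f,P)$ is the first twist coefficient of $f$ at $P$. *)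

(* Defs.v *)
From Stdlib Require Export Reals.
From Stdlib Require Import Lra Lia.
From Coquelicot Require Export Coquelicot.
Open Scope R_scope.

(** * The norm and the table *)

Definition vminus (p q : R * R) : R * R := (fst p - fst q, snd p - snd q).

(* The fourth root is [sqrt (sqrt _)]: [Rpower 0 (/ 4)] is 1, not 0. *)
Definition minkowski (a b : R) (v : R * R) : R :=
  a * sqrt (fst v ^ 2 + snd v ^ 2) + b * sqrt (sqrt (fst v ^ 4 + snd v ^ 4)).

(* [c n] is the coefficient alpha_{2n}. *)
Definition even_poly (c : nat -> R) (N : nat) (t : R) : R :=
  sum_n_m (fun n => c n * t ^ (2 * n)) 1 N.

Definition gamma0 (alpha : R -> R) (t : R) : R * R := (alpha t, t).

Definition gamma1 (L : R) (alpha : R -> R) (t : R) : R * R := (L - alpha t, - t).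

(* [t] is the parameter of the arc [gamma], |t| < eps, as a function of the
   F-arc-length s, |s| < delta, measured from the vertex.  Both arcs are run
   counterclockwise around the table when [t] is decreasing.  As alpha'(0) = 0
   and F(0, -1) = F(0, 1) = 1, this forces t'(0) = -1, i.e. the initial
   velocities (0, -1) on [gamma0] and (0, 1) on [gamma1]. *)
Definition is_arclength_parameter (F : R * R -> R) (eps delta : R)
    (gamma : R -> R * R) (t : R -> R) : Prop :=
  t 0 = 0 /\
  forall s, Rabs s < delta ->
    Rabs (t s) < eps /\
    (exists dt, is_derive t s dt /\ dt < 0) /\
    (exists v : R * R,
        is_derive (fun x => fst (gamma (t x))) s (fst v) /\
        is_derive (fun x => snd (gamma (t x))) s (snd v) /\
        F v = 1).

(* Euclidean radius of curvature of a plane curve, in any parametrization. *)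
Definition radius_of_curvature (g : R -> R * R) (s : R) : R :=
  let x := fun r => fst (g r) in
  let y := fun r => snd (g r) in
  sqrt (Derive x s ^ 2 + Derive y s ^ 2) ^ 3 /
  Rabs (Derive x s * Derive_n y 2 s - Derive y s * Derive_n x 2 s).

(** * The billiard map *)

(* [u] is the second coordinate of the phase point at [c s] directed to [q]. *)
Definition is_phase_coordinate (F : R * R -> R) (c : R -> R * R)
    (s : R) (q : R * R) (u : R) : Prop :=
  is_derive (fun x => F (vminus q (c x))) s u.

(* The ray from [p] to [c s] is reflected to the ray from [c s] to [q]. *)
Definition reflected (F : R * R -> R) (c : R -> R * R)
    (p : R * R) (s : R) (q : R * R) : Prop :=
  is_derive (fun x => F (vminus (c x) p) + F (vminus q (c x))) s 0.

(* The ray from [g0 s] hits [g1] at [g1 s1] and is reflected towards [g0 s2].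
   The rotation by PI identifies the resulting phase point over [g1] with the
   phase point over [g0] that has the same coordinates; see [rot_gamma1] and
   [is_phase_coordinate_rot] below. *)
Definition one_step_billiard (F : R * R -> R) (delta : R) (g0 g1 : R -> R * R)
    (p p1 : R * R) : Prop :=
  let (s, u) := p in
  let (s1, u1) := p1 in
  Rabs s < delta /\ Rabs s1 < delta /\
  is_phase_coordinate F g0 s (g1 s1) u /\
  exists s2, Rabs s2 < delta /\
    reflected F g1 (g0 s) s1 (g0 s2) /\
    is_phase_coordinate F g1 s1 (g0 s2) u1.

Definition is_one_step_billiard_map (F : R * R -> R) (delta : R)
    (g0 g1 : R -> R * R) (T : R * R -> R * R) : Prop :=
  T (0, 0) = (0, 0) /\
  continuous T (0, 0) /\
  locally_2d (fun s u => one_step_billiard F delta g0 g1 (s, u) (T (s, u))) 0 0.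

(** * Elliptic fixed points and the first twist coefficient *)

(* [lambda] is an eigenvalue of the real matrix [[m11, m12], [m21, m22]]. *)
Definition is_eigenvalue (m11 m12 m21 m22 : R) (lambda : C) : Prop :=
  exists z w : C, (z, w) <> (RtoC 0, RtoC 0) /\
    (RtoC m11 * z + RtoC m12 * w = lambda * z)%C /\
    (RtoC m21 * z + RtoC m22 * w = lambda * w)%C.

(* The origin is an elliptic fixed point of [f] and lambda^4 <> 1. *)
Definition elliptic_nonresonant (f : R * R -> R * R) : Prop :=
  f (0, 0) = (0, 0) /\
  exists m11 m12 m21 m22 : R,
    differentiable_pt_lim (fun s u => fst (f (s, u))) 0 0 m11 m12 /\
    differentiable_pt_lim (fun s u => snd (f (s, u))) 0 0 m21 m22 /\
    forall lambda : C, is_eigenvalue m11 m12 m21 m22 lambda ->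
      Cmod lambda = 1 /\ lambda <> RtoC 1 /\ lambda <> RtoC (-1) /\
      (lambda ^ 4)%C <> RtoC 1.

Definition smooth_near_origin (f : R -> R -> R) : Prop :=
  locally_2d (fun s u => forall n, ex_diff_n f n s u) 0 0.

(* Smooth local coordinates centered at the origin, dX /\ dY = ds /\ du. *)
Definition symplectic_coordinates (X Y : R -> R -> R) : Prop :=
  X 0 0 = 0 /\ Y 0 0 = 0 /\
  smooth_near_origin X /\ smooth_near_origin Y /\
  locally_2d (fun s u =>
    Derive (fun r => X r u) s * Derive (fun r => Y s r) u
    - Derive (fun r => X s r) u * Derive (fun r => Y r u) s = 1) 0 0.

(* The normal form is written in the original coordinates (s, u), and the terms
   of order at least 4 are a O(|(X, Y)|^4). *)
Definition is_first_twist_coefficient (f : R * R -> R * R) (tau : R) : Prop :=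
  elliptic_nonresonant f /\
  exists (X Y : R -> R -> R) (theta : R),
    symplectic_coordinates X Y /\
    exists K : R, locally_2d (fun s u =>
      let x := X s u in
      let y := Y s u in
      let (s1, u1) := f (s, u) in
      let Theta := theta + tau * (x ^ 2 + y ^ 2) in
      Rabs (X s1 u1 - (cos Theta * x - sin Theta * y)) <= K * (x ^ 2 + y ^ 2) ^ 2 /\
      Rabs (Y s1 u1 - (sin Theta * x + cos Theta * y)) <= K * (x ^ 2 + y ^ 2) ^ 2)
      0 0.

(** * The symmetry of the table *)

Definition rot_pi (L : R) (p : R * R) : R * R := (L - fst p, - snd p).

Lemma rot_gamma1 (L : R) (alpha : R -> R) (t : R) :
  rot_pi L (gamma1 L alpha t) = gamma0 alpha t.
Proof. unfold rot_pi, gamma0, gamma1; simpl; f_equal; ring. Qed.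

Lemma minkowski_vminus_rot (a b L : R) (p q : R * R) :
  minkowski a b (vminus (rot_pi L p) (rot_pi L q)) = minkowski a b (vminus p q).
Proof.
unfold minkowski, vminus, rot_pi; simpl fst; simpl snd.
replace (L - fst p - (L - fst q)) with (- (fst p - fst q)) by ring.
replace (- snd p - - snd q) with (- (snd p - snd q)) by ring.
f_equal; f_equal; f_equal; [|f_equal]; ring.
Qed.

Lemma is_phase_coordinate_rot (a b L : R) (c : R -> R * R) (s : R)
    (q : R * R) (u : R) :
  is_phase_coordinate (minkowski a b) c s q u <->
  is_phase_coordinate (minkowski a b) (fun x => rot_pi L (c x)) s (rot_pi L q) u.
Proof.
split; apply is_derive_ext; intros x; now rewrite minkowski_vminus_rot.
Qed.

Lemma radius_of_curvature_rot (L : R) (g : R -> R * R) (s : R) :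
  radius_of_curvature (fun x => rot_pi L (g x)) s = radius_of_curvature g s.
Proof.
assert (Hd : forall f x, Derive (fun r => L - f r) x = - Derive f x).
{ intros f x; rewrite <- Derive_opp; unfold Derive; f_equal.
  apply Lim_ext; intros h; unfold Rdiv; ring. }
assert (Hd2 : forall f x, Derive_n (fun r => L - f r) 2 x = - Derive_n f 2 x).
{ intros f x; simpl; rewrite <- Derive_opp; apply Derive_ext; intros r; apply Hd. }
unfold radius_of_curvature, rot_pi; cbn [fst snd].
rewrite Hd, Hd2, Derive_opp, Derive_n_opp.
f_equal; [f_equal; f_equal|f_equal]; ring.
Qed.

(* Main.v *)
Require Import Defs.
From Stdlib Require Import Reals.
From Coquelicot Require Import Coquelicot.
From Stdlib Require Import Lra Lia Psatz FunctionalExtensionality.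
Open Scope R_scope.

(** The F-distance l(s, v) between the points of parameters s and v on the two arcs
   is symmetric and generates the one-step billiard map: u = d_1 l(s, s1), and the
   reflection law gives u1 = - d_1 l(s1, s).  Put kap = a / L, c = L / (a R) - 1.
   To fourth order
     l = L + kap (s v - c (s^2 + v^2) / 2)
         + e1 (s^4 + v^4) + e2 (s^3 v + s v^3) + e3 s^2 v^2,
   where e1, e2, e3 come from the expansions of the norm near the horizontal
   direction, of alpha and of the arc length ([phase_expansion]).  The map is only
   known to be continuous at the fixed point, but this is enough to solve the two
   implicit equations for (s1, u1) up to fourth order errors
   ([implicit_map_expansion]).

   Both diagonal entries of the linear part are c and its determinant is 1, so it is
   elliptic iff |c| < 1, and then lambda^4 = 1 iff c = 0
   ([elliptic_nonresonant_iff]).  For a suitable p the linear part is the rotation by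
   theta = - acos c in the coordinates x = p s, y = u / p.

   With z = x + i y and lambda = e^(i theta) write the map as
   z -> lambda z + (cubic terms) + O(|z|^4), and let C be the coefficient of
   z^2 conj(z).  If smooth coordinates conjugate the map to the twist normal form,
   then their linear part is a rotation, and comparing the coefficients of
   z^2 conj(z) gives C = i lambda tau whatever the quadratic and cubic parts of the
   coordinates are ([twist_coefficient_unique]).  Conversely, the remaining cubic
   terms are removed by the flow of a quartic Hamiltonian.  As l is symmetric, the
   reflection y -> - y conjugates the map to its inverse, so that a Hamiltonian
   k1 x^3 y + k2 x y^3 suffices; it is realized, up to order four, by four polynomial
   shears, which are exactly area-preserving ([polynomial_coordinates_exist],
   [twist_coefficient_exists]).

   Finally tau is - 4 times the mean over phi of the quartic part of l at
   (cos phi, cos (phi + theta)), divided by p^4 ([generating_map_twist]); inserting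
   e1, e2, e3, R = 1 / (2 c1) and R'' = 6 c1 - 6 c4 / c1^2, where
   alpha = c1 t^2 + c4 t^4 + O(t^6), gives the formula. *)

(** * Orders of vanishing at the origin of the plane *)

(** [Ob n f]: f(s, u) = O((|s| + |u|)^n) as (s, u) tends to the origin. *)
Definition Ob (n : nat) (f : R -> R -> R) : Prop :=
  exists K : R, locally_2d (fun s u =>
    Rabs (f s u) <= K * (Rabs s + Rabs u) ^ n) 0 0.

Lemma sum_abs_ge0 (s u : R) : 0 <= Rabs s + Rabs u.
Proof. pose proof (Rabs_pos s); pose proof (Rabs_pos u); lra. Qed.

Lemma Ob_elim (n : nat) (f : R -> R -> R) :
  Ob n f -> exists (K : R) (d : posreal), 0 <= K /\ d <= 1 /\
    forall s u, Rabs s < d -> Rabs u < d ->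
      Rabs (f s u) <= K * (Rabs s + Rabs u) ^ n.
Proof.
intros [K [d H]].
assert (Hd : 0 < Rmin d 1) by (apply Rmin_glb_lt; [apply cond_pos | lra]).
exists (Rmax K 0), (mkposreal _ Hd); simpl.
split; [apply Rmax_r | split; [apply Rmin_r |]].
intros s u Hs Hu.
apply Rle_trans with (K * (Rabs s + Rabs u) ^ n).
- apply H; rewrite Rminus_0_r.
  + apply Rlt_le_trans with (1 := Hs); apply Rmin_l.
  + apply Rlt_le_trans with (1 := Hu); apply Rmin_l.
- apply Rmult_le_compat_r; [apply pow_le, sum_abs_ge0 | apply Rmax_l].
Qed.

Lemma Ob_intro (n : nat) (f : R -> R -> R) (K d : R) :
  0 < d ->
  (forall s u, Rabs s < d -> Rabs u < d ->
    Rabs (f s u) <= K * (Rabs s + Rabs u) ^ n) -> Ob n f.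
Proof.
intros Hd H; exists K, (mkposreal d Hd); simpl; intros s u.
rewrite !Rminus_0_r; auto.
Qed.

Lemma Ob_ext_loc (n : nat) (f g : R -> R -> R) :
  locally_2d (fun s u => f s u = g s u) 0 0 -> Ob n f -> Ob n g.
Proof.
intros He [K H]; exists K; revert H; apply locally_2d_impl.
revert He; apply locally_2d_impl.
apply locally_2d_forall; intros s u E; now rewrite E.
Qed.

Lemma Ob_ext (n : nat) (f g : R -> R -> R) :
  (forall s u, f s u = g s u) -> Ob n f -> Ob n g.
Proof. intros H; apply Ob_ext_loc, locally_2d_forall, H. Qed.

Lemma Ob_plus (n : nat) (f g : R -> R -> R) :
  Ob n f -> Ob n g -> Ob n (fun s u => f s u + g s u).
Proof.
intros Hf Hg.
destruct (Ob_elim _ _ Hf) as (K & d & HK & _ & H).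
destruct (Ob_elim _ _ Hg) as (K' & d' & HK' & _ & H').
apply (Ob_intro _ _ (K + K') (Rmin d d')).
{ apply Rmin_glb_lt; apply cond_pos. }
intros s u Hs Hu.
pose proof (Rmin_l d d'); pose proof (Rmin_r d d').
eapply Rle_trans; [apply Rabs_triang |].
rewrite Rmult_plus_distr_r; apply Rplus_le_compat; [apply H | apply H']; lra.
Qed.

Lemma Ob_opp (n : nat) (f : R -> R -> R) : Ob n f -> Ob n (fun s u => - f s u).
Proof.
intros [K H]; exists K; revert H; apply locally_2d_impl.
apply locally_2d_forall; intros s u; now rewrite Rabs_Ropp.
Qed.

Lemma Ob_minus (n : nat) (f g : R -> R -> R) :
  Ob n f -> Ob n g -> Ob n (fun s u => f s u - g s u).
Proof. intros Hf Hg; apply Ob_plus; [| apply Ob_opp]; assumption. Qed.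

Lemma Ob_mult (m n : nat) (f g : R -> R -> R) :
  Ob m f -> Ob n g -> Ob (m + n) (fun s u => f s u * g s u).
Proof.
intros Hf Hg.
destruct (Ob_elim _ _ Hf) as (K & d & HK & _ & H).
destruct (Ob_elim _ _ Hg) as (K' & d' & HK' & _ & H').
apply (Ob_intro _ _ (K * K') (Rmin d d')).
{ apply Rmin_glb_lt; apply cond_pos. }
intros s u Hs Hu.
pose proof (Rmin_l d d'); pose proof (Rmin_r d d').
rewrite Rabs_mult, pow_add.
replace (K * K' * ((Rabs s + Rabs u) ^ m * (Rabs s + Rabs u) ^ n))
  with ((K * (Rabs s + Rabs u) ^ m) * (K' * (Rabs s + Rabs u) ^ n)) by ring.
apply Rmult_le_compat; try apply Rabs_pos; [apply H | apply H']; lra.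
Qed.

Lemma Ob_const (k : R) : Ob 0 (fun _ _ => k).
Proof.
apply (Ob_intro _ _ (Rabs k) 1); [lra |]; intros; simpl; lra.
Qed.

Lemma Ob_scal (n : nat) (k : R) (f : R -> R -> R) :
  Ob n f -> Ob n (fun s u => k * f s u).
Proof. apply (Ob_mult 0 n); apply Ob_const. Qed.

Lemma Ob_fst : Ob 1 (fun s _ => s).
Proof.
apply (Ob_intro _ _ 1 1); [lra |]; intros s u _ _.
pose proof (Rabs_pos u); simpl; lra.
Qed.

Lemma Ob_snd : Ob 1 (fun _ u => u).
Proof.
apply (Ob_intro _ _ 1 1); [lra |]; intros s u _ _.
pose proof (Rabs_pos s); simpl; lra.
Qed.

Lemma Ob_le (m n : nat) (f : R -> R -> R) : (m <= n)%nat -> Ob n f -> Ob m f.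
Proof.
intros Hmn Hf; destruct (Ob_elim _ _ Hf) as (K & d & HK & Hd & H).
apply (Ob_intro _ _ (K * 2 ^ (n - m)) d); [apply cond_pos |].
intros s u Hs Hu; eapply Rle_trans; [apply H; assumption |].
replace n with (m + (n - m))%nat at 1 by lia.
rewrite pow_add.
replace (K * 2 ^ (n - m) * (Rabs s + Rabs u) ^ m)
  with (K * ((Rabs s + Rabs u) ^ m * 2 ^ (n - m))) by ring.
apply Rmult_le_compat_l; [assumption |].
apply Rmult_le_compat_l; [apply pow_le, sum_abs_ge0 |].
apply pow_incr; split; [apply sum_abs_ge0 | lra].
Qed.

Lemma Ob_comp (n : nat) (f g h : R -> R -> R) :
  Ob n f -> Ob 1 g -> Ob 1 h -> Ob n (fun s u => f (g s u) (h s u)).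
Proof.
intros Hf Hg Hh.
destruct (Ob_elim _ _ Hf) as (K & d & HK & _ & H).
destruct (Ob_elim _ _ Hg) as (K1 & d1 & HK1 & _ & H1).
destruct (Ob_elim _ _ Hh) as (K2 & d2 & HK2 & _ & H2).
set (M := K1 + K2 + 1).
assert (HM : 0 < 2 * M) by (unfold M; lra).
assert (Hdd : 0 < d / (2 * M)) by (apply Rdiv_lt_0_compat; [apply cond_pos | assumption]).
apply (Ob_intro _ _ (K * M ^ n) (Rmin (d / (2 * M)) (Rmin d1 d2))).
{ repeat apply Rmin_glb_lt; try apply cond_pos; assumption. }
intros s u Hs Hu.
pose proof (Rmin_l (d / (2 * M)) (Rmin d1 d2)).
pose proof (Rmin_r (d / (2 * M)) (Rmin d1 d2)).
pose proof (Rmin_l d1 d2); pose proof (Rmin_r d1 d2).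
pose proof (sum_abs_ge0 s u) as Hr.
assert (HA : Rabs (g s u) <= K1 * (Rabs s + Rabs u)).
{ rewrite <- (pow_1 (Rabs s + Rabs u)); apply H1; lra. }
assert (HB : Rabs (h s u) <= K2 * (Rabs s + Rabs u)).
{ rewrite <- (pow_1 (Rabs s + Rabs u)); apply H2; lra. }
assert (HC : M * (Rabs s + Rabs u) < d).
{ apply Rlt_le_trans with (M * (d / (2 * M) + d / (2 * M))).
  - apply Rmult_lt_compat_l; [unfold M; lra | lra].
  - right; field; unfold M; lra. }
assert (HD : Rabs (g s u) + Rabs (h s u) <= M * (Rabs s + Rabs u)).
{ unfold M; nra. }
pose proof (Rabs_pos (g s u)); pose proof (Rabs_pos (h s u)).
eapply Rle_trans; [apply H; lra |].
rewrite Rmult_assoc, <- Rpow_mult_distr.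
apply Rmult_le_compat_l; [assumption |].
apply pow_incr; lra.
Qed.

Lemma Ob_comp1 (n : nat) (f : R -> R) (g : R -> R -> R) (K d : R) :
  0 < d -> (forall x, Rabs x < d -> Rabs (f x) <= K * Rabs x ^ n) ->
  Ob 1 g -> Ob n (fun s u => f (g s u)).
Proof.
intros Hd Hf Hg; apply (Ob_comp n (fun x _ => f x) g g); try assumption.
apply (Ob_intro _ _ (Rmax K 0) d); [assumption |]; intros x y Hx _.
eapply Rle_trans; [apply Hf; assumption |].
apply Rle_trans with (Rmax K 0 * Rabs x ^ n).
- apply Rmult_le_compat_r; [apply pow_le, Rabs_pos | apply Rmax_l].
- apply Rmult_le_compat_l; [apply Rmax_r |].
  apply pow_incr; pose proof (Rabs_pos x); pose proof (Rabs_pos y); lra.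
Qed.

Lemma Ob_swap (n : nat) (f : R -> R -> R) : Ob n f -> Ob n (fun s u => f u s).
Proof.
intros [K [d H]]; exists K, d; intros s u Hs Hu; rewrite Rplus_comm; auto.
Qed.

Lemma Ob_of_diff (n : nat) (f g : R -> R -> R) :
  Ob n (fun s u => f s u - g s u) -> Ob n g -> Ob n f.
Proof.
intros H Hg; apply Ob_ext with (fun s u => (f s u - g s u) + g s u);
  [intros; ring | now apply Ob_plus].
Qed.

Lemma Ob_small (f : R -> R -> R) (e : R) :
  0 < e -> Ob 1 f -> locally_2d (fun s u => Rabs (f s u) < e) 0 0.
Proof.
intros He Hf; destruct (Ob_elim _ _ Hf) as (K & d & HK & _ & H).
assert (Hq : 0 < e / (2 * (K + 1))) by (apply Rdiv_lt_0_compat; lra).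
assert (Hmin : 0 < Rmin d (e / (2 * (K + 1)))).
{ apply Rmin_glb_lt; [apply cond_pos | assumption]. }
exists (mkposreal _ Hmin); simpl; intros s v; rewrite !Rminus_0_r; intros Hs Hv.
pose proof (Rmin_l d (e / (2 * (K + 1)))); pose proof (Rmin_r d (e / (2 * (K + 1)))).
eapply Rle_lt_trans; [apply H; lra |]; rewrite pow_1.
pose proof (sum_abs_ge0 s v) as Hr.
apply Rle_lt_trans with ((K + 1) * (Rabs s + Rabs v)); [nra |].
apply Rlt_le_trans with ((K + 1) * (2 * (e / (2 * (K + 1))))).
- apply Rmult_lt_compat_l; lra.
- right; field; lra.
Qed.

Lemma Ob_of_bound (n : nat) (f g : R -> R -> R) (K : R) :
  locally_2d (fun s u => Rabs (f s u) <= K * Rabs (g s u)) 0 0 -> Ob n g -> Ob n f.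
Proof.
intros Hloc [K' Hg]; exists (Rmax K 0 * K').
generalize (locally_2d_and _ _ _ _ Hloc Hg).
apply locally_2d_impl, locally_2d_forall; intros s u [H1 H2].
eapply Rle_trans; [exact H1 |].
apply Rle_trans with (Rmax K 0 * Rabs (g s u)).
- apply Rmult_le_compat_r; [apply Rabs_pos | apply Rmax_l].
- rewrite Rmult_assoc; apply Rmult_le_compat_l; [apply Rmax_r | assumption].
Qed.

Lemma Ob_pow (m k : nat) (f : R -> R -> R) :
  Ob m f -> Ob (k * m) (fun s u => f s u ^ k).
Proof.
intros Hf; induction k as [|k IH]; simpl.
- apply Ob_const.
- apply (Ob_mult m (k * m)); assumption.
Qed.

Lemma Ob_div (m : nat) (k : R) (f : R -> R -> R) :
  Ob m f -> Ob m (fun s u => f s u / k).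
Proof.
intros Hf; apply Ob_ext with (fun s u => / k * f s u);
  [intros; unfold Rdiv; ring | now apply Ob_scal].
Qed.

(** [ob_deg F] computes an order of vanishing of an arithmetic expression from its
   shape and from the hypotheses on its subterms; [ob] proves [Ob n F] when [n] is
   at most this order. *)
Ltac ob_deg F :=
  match F with
  | _ => match goal with H : Ob ?m F |- _ => m end
  | (fun s u => @?f s u + @?g s u) =>
      let m := ob_deg f in let n := ob_deg g in eval compute in (Nat.min m n)
  | (fun s u => @?f s u - @?g s u) =>
      let m := ob_deg f in let n := ob_deg g in eval compute in (Nat.min m n)
  | (fun s u => @?f s u * @?g s u) =>
      let m := ob_deg f in let n := ob_deg g in eval compute in (m + n)%nat
  | (fun s u => - @?f s u) => ob_deg f
  | (fun s u => @?f s u / ?k) => ob_deg f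
  | (fun s u => @?f s u ^ ?k) =>
      let m := ob_deg f in eval compute in (k * m)%nat
  | (fun s u => s) => constr:(1%nat)
  | (fun s u => u) => constr:(1%nat)
  | (fun s u => ?k) => constr:(0%nat)
  end.

Ltac ob :=
  lazymatch goal with |- Ob ?n ?F =>
    let d := ob_deg F in apply (Ob_le n d); [lia | ob_struct]
  end
with ob_struct :=
  match goal with
  | H : Ob ?m ?F |- Ob ?m ?F => exact H
  | |- Ob _ (fun s u => @?f s u + @?g s u) => refine (Ob_plus _ f g _ _); ob
  | |- Ob _ (fun s u => @?f s u - @?g s u) => refine (Ob_minus _ f g _ _); ob
  | |- Ob _ (fun s u => @?f s u * @?g s u) =>
      let m := ob_deg f in let n := ob_deg g in
      refine (Ob_mult m n f g _ _); ob_struct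
  | |- Ob _ (fun s u => - @?f s u) => refine (Ob_opp _ f _); ob_struct
  | |- Ob _ (fun s u => @?f s u / ?k) => refine (Ob_div _ k f _); ob_struct
  | |- Ob _ (fun s u => @?f s u ^ ?k) =>
      let m := ob_deg f in refine (Ob_pow m k f _); ob_struct
  | |- Ob _ (fun s u => s) => exact Ob_fst
  | |- Ob _ (fun s u => u) => exact Ob_snd
  | |- Ob _ (fun s u => ?k) => exact (Ob_const k)
  end.

(** * Elementary estimates in one variable *)

Lemma Rabs_le_between0 (c x : R) :
  Rmin 0 x <= c <= Rmax 0 x -> Rabs c <= Rabs x.
Proof.
unfold Rmin, Rmax; destruct (Rle_dec 0 x); intros H;
  unfold Rabs; destruct (Rcase_abs c), (Rcase_abs x); lra.
Qed.

(** A bound on the derivative gives, by the mean value theorem, a bound of one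
   order more on a function vanishing at 0. *)
Lemma derive_bound (f df : R -> R) (d K : R) (n : nat) :
  f 0 = 0 -> 0 <= K ->
  (forall x, Rabs x < d -> is_derive f x (df x)) ->
  (forall x, Rabs x < d -> Rabs (df x) <= K * Rabs x ^ n) ->
  forall x, Rabs x < d -> Rabs (f x) <= K * Rabs x ^ S n.
Proof.
intros H0 HK Hf Hdf x Hx.
destruct (MVT_gen f 0 x df) as (c & Hc & E).
- intros y Hy; apply Hf, Rle_lt_trans with (2 := Hx), Rabs_le_between0; lra.
- intros y Hy; apply derivable_continuous_pt; exists (df y).
  apply is_derive_Reals, Hf, Rle_lt_trans with (2 := Hx), Rabs_le_between0; lra.
- rewrite H0, !Rminus_0_r in E; rewrite E, Rabs_mult.
  pose proof (Rabs_le_between0 _ _ Hc) as Hcx.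
  replace (K * Rabs x ^ S n) with (K * Rabs x ^ n * Rabs x) by (simpl; ring).
  apply Rmult_le_compat_r; [apply Rabs_pos |].
  eapply Rle_trans; [apply Hdf, Rle_lt_trans with (2 := Hx), Hcx |].
  apply Rmult_le_compat_l; [assumption |].
  apply pow_incr; split; [apply Rabs_pos | assumption].
Qed.

Lemma abs_pow4 (x : R) : Rabs x ^ 4 = x ^ 4.
Proof. replace (Rabs x ^ 4) with ((Rabs x ^ 2) ^ 2) by ring; rewrite pow2_abs; ring. Qed.

Lemma sin_abs_bound (x : R) : Rabs (sin x) <= 1 * Rabs x ^ 1.
Proof.
apply (derive_bound sin cos (Rabs x + 1) 1 0); [apply sin_0 | lra | | | lra].
- intros y _; apply is_derive_Reals, derivable_pt_lim_sin.
- intros y _; simpl; pose proof (COS_bound y); unfold Rabs; destruct Rcase_abs; lra.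
Qed.

Lemma cos_sub1_bound (x : R) : Rabs (cos x - 1) <= 1 * Rabs x ^ 2.
Proof.
apply (derive_bound (fun y => cos y - 1) (fun y => - sin y) (Rabs x + 1) 1 1);
  [rewrite cos_0; lra | lra | | | lra].
- intros y _; auto_derive; [trivial | ring].
- intros y _; rewrite Rabs_Ropp; apply sin_abs_bound.
Qed.

Lemma sin_sub_id_bound (x : R) : Rabs (sin x - x) <= 1 * Rabs x ^ 3.
Proof.
apply (derive_bound (fun y => sin y - y) (fun y => cos y - 1) (Rabs x + 1) 1 2);
  [rewrite sin_0; lra | lra | | | lra].
- intros y _; auto_derive; [trivial | ring].
- intros y _; apply cos_sub1_bound.
Qed.

Lemma sqrt_ge1 (x : R) : 1 <= x -> 1 <= sqrt x.
Proof. intros H; rewrite <- sqrt_1; now apply sqrt_le_1_alt. Qed.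

Lemma inv_sqrt_expansion (m : R) :
  Rabs (/ sqrt (1 + m ^ 2) - (1 - m ^ 2 / 2)) <= m ^ 4.
Proof.
assert (H0 : 0 <= m ^ 2) by apply pow2_ge_0.
assert (Hw := sqrt_ge1 (1 + m ^ 2) ltac:(lra)).
assert (Hw2 : sqrt (1 + m ^ 2) ^ 2 = 1 + m ^ 2) by (apply pow2_sqrt; lra).
set (w := sqrt (1 + m ^ 2)) in *.
replace (/ w - (1 - m ^ 2 / 2)) with ((w - 1) ^ 2 * ((w + 2) / (2 * w))).
2:{ replace (m ^ 2) with (w ^ 2 - 1) by lra; field; lra. }
replace (m ^ 4) with ((w ^ 2 - 1) ^ 2) by (rewrite Hw2; ring).
assert (H1 : 0 <= (w + 2) / (2 * w) <= 3 / 2).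
{ split.
  - apply Rmult_le_pos; [lra | left; apply Rinv_0_lt_compat; lra].
  - apply Rle_div_l; nra. }
assert (H2 : 0 <= (w - 1) ^ 2) by apply pow2_ge_0.
rewrite Rabs_pos_eq by (apply Rmult_le_pos; lra).
apply Rle_trans with ((w - 1) ^ 2 * (3 / 2)); [apply Rmult_le_compat_l; lra |].
replace ((w ^ 2 - 1) ^ 2) with ((w - 1) ^ 2 * (w + 1) ^ 2) by ring.
apply Rmult_le_compat_l; nra.
Qed.

Lemma sqrt_expansion (m : R) :
  0 <= sqrt (1 + m ^ 2) - 1 <= m ^ 2 /\
  Rabs (sqrt (1 + m ^ 2) - 1 - m ^ 2 / 2) <= m ^ 4.
Proof.
assert (H0 : 0 <= m ^ 2) by apply pow2_ge_0.
assert (Hw := sqrt_ge1 (1 + m ^ 2) ltac:(lra)).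
assert (Hw2 : sqrt (1 + m ^ 2) ^ 2 = 1 + m ^ 2) by (apply pow2_sqrt; lra).
set (w := sqrt (1 + m ^ 2)) in *.
split; [nra |].
replace (w - 1 - m ^ 2 / 2) with (- ((w - 1) ^ 2 / 2)).
2:{ replace (m ^ 2) with (w ^ 2 - 1) by lra; field. }
replace (m ^ 4) with ((w ^ 2 - 1) ^ 2) by (rewrite Hw2; ring).
assert (H2 : 0 <= (w - 1) ^ 2) by apply pow2_ge_0.
rewrite Rabs_Ropp, Rabs_pos_eq by lra.
replace ((w ^ 2 - 1) ^ 2) with ((w - 1) ^ 2 * (w + 1) ^ 2) by ring.
assert (1 <= (w + 1) ^ 2) by nra; nra.
Qed.

(** The fourth root of 1 + m^4. *)
Definition root4 (m : R) : R := sqrt (sqrt (1 + m ^ 4)).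

Lemma pow4_ge0 (m : R) : 0 <= m ^ 4.
Proof. replace (m ^ 4) with ((m ^ 2) ^ 2) by ring; apply pow2_ge_0. Qed.

Lemma root4_ge1 (m : R) : 1 <= root4 m.
Proof. apply sqrt_ge1, sqrt_ge1; pose proof (pow4_ge0 m); lra. Qed.

Lemma root4_sqr (m : R) : root4 m ^ 2 = sqrt (1 + m ^ 4).
Proof. apply pow2_sqrt, sqrt_pos. Qed.

Lemma root4_pow4 (m : R) : root4 m ^ 4 = 1 + m ^ 4.
Proof.
replace (root4 m ^ 4) with ((root4 m ^ 2) ^ 2) by ring.
rewrite root4_sqr; apply pow2_sqrt; pose proof (pow4_ge0 m); lra.
Qed.

Lemma root4_bound (m : R) : 0 <= root4 m - 1 <= m ^ 4.
Proof.
pose proof (root4_ge1 m); pose proof (root4_pow4 m) as E.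
assert (1 <= root4 m ^ 3) by (apply pow_R1_Rle; assumption).
replace (root4 m ^ 4) with (root4 m * root4 m ^ 3) in E by ring; nra.
Qed.

Lemma inv_root4_cube_bound (m : R) : Rabs (/ root4 m ^ 3 - 1) <= m ^ 4.
Proof.
pose proof (root4_ge1 m) as H; pose proof (root4_pow4 m) as E.
assert (H3 : 1 <= root4 m ^ 3) by (apply pow_R1_Rle; assumption).
replace (root4 m ^ 4) with (root4 m * root4 m ^ 3) in E by ring.
set (q := root4 m ^ 3) in *.
assert (Hi : 0 < / q <= 1).
{ split; [apply Rinv_0_lt_compat; lra |].
  rewrite <- Rinv_1; apply Rinv_le_contravar; lra. }
rewrite Rabs_minus_sym, Rabs_pos_eq by lra.
assert (/ q * q = 1) by (field; lra); nra.
Qed.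

(** * The norm *)

(** [Phi0] and [Phi1] are the partial derivatives of the norm at (1, m), hence, by
   homogeneity, at any point x (1, m) with x > 0. *)
Definition Phi0 (a b m : R) : R := a / sqrt (1 + m ^ 2) + b / root4 m ^ 3.
Definition Phi1 (a b m : R) : R := a * m / sqrt (1 + m ^ 2) + b * m ^ 3 / root4 m ^ 3.

Lemma Phi0_expansion (a b m : R) : 0 <= a -> 0 <= b -> a + b = 1 ->
  Rabs (Phi0 a b m - (1 - a / 2 * m ^ 2)) <= 1 * Rabs m ^ 4.
Proof.
intros Ha Hb Hab; rewrite abs_pow4.
replace (Phi0 a b m - (1 - a / 2 * m ^ 2)) with
  (a * (/ sqrt (1 + m ^ 2) - (1 - m ^ 2 / 2)) + b * (/ root4 m ^ 3 - 1)).
2:{ unfold Phi0, Rdiv; replace b with (1 - a) by lra; ring. }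
eapply Rle_trans; [apply Rabs_triang |].
rewrite !Rabs_mult, (Rabs_pos_eq a), (Rabs_pos_eq b) by assumption.
pose proof (inv_sqrt_expansion m); pose proof (inv_root4_cube_bound m).
replace (1 * m ^ 4) with (a * m ^ 4 + b * m ^ 4)
  by (replace b with (1 - a) by lra; ring).
apply Rplus_le_compat; apply Rmult_le_compat_l; assumption.
Qed.

Lemma Phi1_expansion (a b m : R) : 0 <= a -> 0 <= b -> a + b = 1 ->
  Rabs m < 1 ->
  Rabs (Phi1 a b m - (a * m + (b - a / 2) * m ^ 3)) <= 1 * Rabs m ^ 4.
Proof.
intros Ha Hb Hab Hm; rewrite abs_pow4.
replace (Phi1 a b m - (a * m + (b - a / 2) * m ^ 3)) with
  (m * (a * (/ sqrt (1 + m ^ 2) - (1 - m ^ 2 / 2)) + m ^ 2 * (b * (/ root4 m ^ 3 - 1)))).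
2:{ unfold Phi1, Rdiv; field; pose proof (root4_ge1 m); split; [lra |].
    pose proof (sqrt_ge1 (1 + m ^ 2)); pose proof (pow2_ge_0 m); lra. }
rewrite Rabs_mult.
apply Rle_trans with (1 * (1 * m ^ 4)); [| lra].
apply Rmult_le_compat; try apply Rabs_pos; [lra |].
eapply Rle_trans; [apply Rabs_triang |].
rewrite !Rabs_mult, (Rabs_pos_eq a), (Rabs_pos_eq b) by assumption.
pose proof (inv_sqrt_expansion m); pose proof (inv_root4_cube_bound m).
replace (1 * m ^ 4) with (a * m ^ 4 + 1 * (b * m ^ 4))
  by (replace b with (1 - a) by lra; ring).
apply Rplus_le_compat; [apply Rmult_le_compat_l; assumption |].
apply Rmult_le_compat; try apply Rabs_pos.
- apply Rmult_le_pos; [assumption | apply Rabs_pos].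
- rewrite Rabs_pos_eq by apply pow2_ge_0; rewrite <- pow2_abs.
  pose proof (Rabs_pos m); nra.
- apply Rmult_le_compat_l; assumption.
Qed.

(** The norm F(x, 1) of the velocity of the arc t -> (alpha(t), t) at a point where
   alpha' = x. *)
Definition speed (a b x : R) : R := a * sqrt (1 + x ^ 2) + b * root4 x.

Lemma speed_ge1 (a b x : R) : 0 <= a -> 0 <= b -> a + b = 1 -> 1 <= speed a b x.
Proof.
intros Ha Hb Hab; unfold speed; pose proof (root4_ge1 x).
assert (1 <= sqrt (1 + x ^ 2)) by (apply sqrt_ge1; pose proof (pow2_ge_0 x); lra).
nra.
Qed.

Lemma inv_speed_expansion (a b x : R) : 0 <= a -> 0 <= b -> a + b = 1 ->
  Rabs x < 1 ->
  Rabs (- / speed a b x - (- 1 + a / 2 * x ^ 2)) <= 6 * Rabs x ^ 4.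
Proof.
intros Ha Hb Hab Hx; rewrite abs_pow4.
pose proof (speed_ge1 a b x Ha Hb Hab) as H1.
destruct (sqrt_expansion x) as [Hs1 Hs2]; pose proof (root4_bound x) as Hr.
assert (Hf : speed a b x - 1 - a / 2 * x ^ 2 =
  a * (sqrt (1 + x ^ 2) - 1 - x ^ 2 / 2) + b * (root4 x - 1)).
{ unfold speed; replace b with (1 - a) by lra; field. }
assert (Hx4 : x ^ 4 <= x ^ 2).
{ replace (x ^ 4) with (x ^ 2 * x ^ 2) by ring; rewrite <- !(pow2_abs x).
  pose proof (Rabs_pos x); assert (Rabs x ^ 2 <= 1) by nra.
  pose proof (pow2_ge_0 (Rabs x)); nra. }
assert (Hd : Rabs (speed a b x - 1 - a / 2 * x ^ 2) <= x ^ 4).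
{ rewrite Hf; eapply Rle_trans; [apply Rabs_triang |].
  rewrite !Rabs_mult, (Rabs_pos_eq a), (Rabs_pos_eq b) by assumption.
  rewrite (Rabs_pos_eq (root4 x - 1)) by lra.
  replace (x ^ 4) with (a * x ^ 4 + b * x ^ 4)
    by (replace b with (1 - a) by lra; ring).
  apply Rplus_le_compat; apply Rmult_le_compat_l; lra. }
assert (Hp : 0 <= x ^ 2) by apply pow2_ge_0.
assert (Hv : 0 <= speed a b x - 1 <= 2 * x ^ 2).
{ split; [lra |]; unfold speed.
  assert (a * (sqrt (1 + x ^ 2) - 1) <= 1 * x ^ 2) by (apply Rmult_le_compat; lra).
  assert (b * (root4 x - 1) <= 1 * x ^ 4) by (apply Rmult_le_compat; lra).
  lra. }
set (v := speed a b x) in *.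
replace (- / v - (- 1 + a / 2 * x ^ 2)) with
  ((v - 1 - a / 2 * x ^ 2) - (v - 1) ^ 2 / v) by (field; lra).
eapply Rle_trans; [apply Rabs_triang |]; rewrite Rabs_Ropp.
assert (H2 : 0 <= (v - 1) ^ 2 <= 4 * x ^ 4).
{ split; [apply pow2_ge_0 |].
  replace (4 * x ^ 4) with ((2 * x ^ 2) ^ 2) by ring; apply pow_incr; lra. }
assert (H3 : 0 <= (v - 1) ^ 2 / v <= 4 * x ^ 4).
{ split.
  - apply Rmult_le_pos; [lra | left; apply Rinv_0_lt_compat; lra].
  - apply Rle_div_l; nra. }
rewrite (Rabs_pos_eq _ (proj1 H3)); pose proof (pow4_ge0 x); lra.
Qed.

Lemma minkowski_vertical (a b x k : R) : k < 0 ->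
  minkowski a b (k * x, k) = - k * speed a b x.
Proof.
intros Hk; unfold minkowski, speed, root4; cbn [fst snd].
assert (Hk2 : sqrt (k ^ 2) = - k).
{ rewrite <- (pow2_abs k), sqrt_pow2 by apply Rabs_pos; now apply Rabs_left. }
replace ((k * x) ^ 2 + k ^ 2) with (k ^ 2 * (1 + x ^ 2)) by ring.
replace ((k * x) ^ 4 + k ^ 4) with ((k ^ 2) ^ 2 * (1 + x ^ 4)) by ring.
rewrite (sqrt_mult_alt (k ^ 2)), (sqrt_mult_alt ((k ^ 2) ^ 2)) by apply pow2_ge_0.
rewrite (sqrt_pow2 (k ^ 2)), (sqrt_mult_alt (k ^ 2)), Hk2 by apply pow2_ge_0; ring.
Qed.

(** The derivative of the norm along a curve in the right half-plane. *)
Lemma is_derive_minkowski (a b : R) (X Y : R -> R) (r dX dY : R) :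
  0 < X r -> is_derive X r dX -> is_derive Y r dY ->
  is_derive (fun x => minkowski a b (X x, Y x)) r
    (Phi0 a b (Y r / X r) * dX + Phi1 a b (Y r / X r) * dY).
Proof.
intros HX HdX HdY; unfold minkowski; cbn [fst snd].
assert (H2 : 0 < X r ^ 2) by (apply pow_lt; assumption).
assert (H4 : 0 < X r ^ 4) by (apply pow_lt; assumption).
pose proof (pow2_ge_0 (Y r)) as HY2; pose proof (pow4_ge0 (Y r)) as HY4.
assert (HE : sqrt (X r ^ 2 + Y r ^ 2) = X r * sqrt (1 + (Y r / X r) ^ 2)).
{ replace (X r ^ 2 + Y r ^ 2) with (X r ^ 2 * (1 + (Y r / X r) ^ 2)) by (field; lra).
  rewrite sqrt_mult_alt by lra; now rewrite sqrt_pow2 by lra. }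
assert (HE4 : sqrt (X r ^ 4 + Y r ^ 4) = X r ^ 2 * root4 (Y r / X r) ^ 2).
{ rewrite root4_sqr.
  replace (X r ^ 4 + Y r ^ 4) with ((X r ^ 2) ^ 2 * (1 + (Y r / X r) ^ 4)) by (field; lra).
  rewrite sqrt_mult_alt by apply pow2_ge_0; rewrite sqrt_pow2 by lra; reflexivity. }
assert (Hq := root4_ge1 (Y r / X r)).
assert (HE44 : sqrt (sqrt (X r ^ 4 + Y r ^ 4)) = X r * root4 (Y r / X r)).
{ rewrite HE4.
  replace (X r ^ 2 * root4 (Y r / X r) ^ 2) with ((X r * root4 (Y r / X r)) ^ 2) by ring.
  apply sqrt_pow2, Rmult_le_pos; lra. }
assert (Hs := sqrt_ge1 (1 + (Y r / X r) ^ 2)).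
pose proof (pow2_ge_0 (Y r / X r)).
auto_derive.
- assert (E2 : X r * (X r * 1) + Y r * (Y r * 1) = X r ^ 2 + Y r ^ 2) by ring.
  assert (E4 : X r * (X r * (X r * (X r * 1))) + Y r * (Y r * (Y r * (Y r * 1)))
    = X r ^ 4 + Y r ^ 4) by ring.
  rewrite E2, E4.
  repeat split; try (eexists; eassumption); try apply sqrt_lt_R0; lra.
- replace (Derive (fun x => X x) r) with dX by (symmetry; now apply is_derive_unique).
  replace (Derive (fun x => Y x) r) with dY by (symmetry; now apply is_derive_unique).
  replace (X r * (X r * 1) + Y r * (Y r * 1)) with (X r ^ 2 + Y r ^ 2) by ring.
  replace (X r * (X r * (X r * (X r * 1))) + Y r * (Y r * (Y r * (Y r * 1))))
      with (X r ^ 4 + Y r ^ 4) by ring.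
  rewrite HE44, HE, HE4; unfold Phi0, Phi1; simpl INR; field.
  repeat split; lra.
Qed.

(** * The boundary arcs *)

Lemma even_poly_split (c : nat -> R) (N : nat) : (1 <= N)%nat ->
  exists (c4 : R) (q : R -> R), (forall n x, ex_derive_n q n x) /\
    forall x, even_poly c N x = c 1%nat * x ^ 2 + c4 * x ^ 4 + x ^ 6 * q x.
Proof.
induction N as [|N IH]; [lia |]; intros _.
destruct (Nat.eq_dec N 0) as [-> | HN].
{ exists 0, (fun _ => 0); split; [intros; apply ex_derive_n_const |].
  intros x; unfold even_poly; rewrite sum_n_n; simpl; ring. }
destruct IH as (c4 & q & Hq & E); [lia |].
assert (ES : forall x, even_poly c (S N) x = even_poly c N x + c (S N) * x ^ (2 * S N)).
{ intros x; unfold even_poly; now rewrite sum_n_Sm by lia. }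
destruct (Nat.eq_dec N 1) as [-> | HN1].
- exists (c4 + c 2%nat), q; split; [assumption |].
  intros x; rewrite ES, E; simpl; ring.
- exists c4, (fun x => q x + c (S N) * x ^ (2 * (N - 2))); split.
  + intros n x; apply ex_derive_n_plus; apply filter_forall; intros y j _.
    * apply Hq.
    * apply ex_derive_n_scal_l, ex_derive_n_pow.
  + intros x; rewrite ES, E.
    replace (2 * S N)%nat with (6 + 2 * (N - 2))%nat by lia.
    rewrite pow_add; ring.
Qed.

(** The derivatives of an even polynomial with their expansions at 0. *)
Lemma even_poly_derivatives (c : nat -> R) (N : nat) : (1 <= N)%nat ->
  exists (c4 : R) (q0 q1 q2 q3 d1 d2 d3 : R -> R),
    (forall x, ex_derive q0 x /\ ex_derive q1 x /\ ex_derive q2 x /\ ex_derive q3 x) /\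
    (forall x, even_poly c N x = c 1%nat * x ^ 2 + c4 * x ^ 4 + x ^ 6 * q0 x) /\
    (forall x, d1 x = 2 * c 1%nat * x + 4 * c4 * x ^ 3 + x ^ 5 * q1 x) /\
    (forall x, d2 x = 2 * c 1%nat + 12 * c4 * x ^ 2 + x ^ 4 * q2 x) /\
    (forall x, d3 x = 24 * c4 * x + x ^ 3 * q3 x) /\
    (forall x, is_derive (even_poly c N) x (d1 x)) /\
    (forall x, is_derive d1 x (d2 x)) /\
    (forall x, is_derive d2 x (d3 x)).
Proof.
intros HN; destruct (even_poly_split c N HN) as (c4 & q & Hq & E).
set (q' := Derive q); set (q'' := Derive q'); set (q''' := Derive q'').
assert (H0 : forall x, ex_derive q x) by (intros x; apply (Hq 1%nat)).
assert (H1 : forall x, ex_derive q' x) by (intros x; apply (Hq 2%nat)).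
assert (H2 : forall x, ex_derive q'' x) by (intros x; apply (Hq 3%nat)).
assert (H3 : forall x, ex_derive q''' x) by (intros x; apply (Hq 4%nat)).
set (q1 := fun x => 6 * q x + x * q' x).
set (q2 := fun x => 5 * q1 x + x * (7 * q' x + x * q'' x)).
set (q3 := fun x => 4 * q2 x + x * (5 * (7 * q' x + x * q'' x) +
  (7 * q' x + x * q'' x) + x * (8 * q'' x + x * q''' x))).
exists c4, q, q1, q2, q3.
exists (fun x => 2 * c 1%nat * x + 4 * c4 * x ^ 3 + x ^ 5 * q1 x).
exists (fun x => 2 * c 1%nat + 12 * c4 * x ^ 2 + x ^ 4 * q2 x).
exists (fun x => 24 * c4 * x + x ^ 3 * q3 x).
split; [| split; [assumption |]].
{ intros x; unfold q3, q2, q1; split; [| split; [| split]];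
    auto_derive; repeat split; auto. }
do 3 (split; [reflexivity |]); split; [| split].
- intros x.
  apply is_derive_ext with (fun x => c 1%nat * x ^ 2 + c4 * x ^ 4 + x ^ 6 * q x);
    [intros y; now rewrite E |].
  auto_derive; [repeat split; auto |].
  unfold q1; change (Derive (fun x0 => q x0) x) with (q' x); ring.
- intros x; unfold q2, q1; auto_derive; [repeat split; auto |].
  change (Derive (fun x0 => q x0) x) with (q' x).
  change (Derive (fun x0 => q' x0) x) with (q'' x); ring.
- intros x; unfold q3, q2, q1; auto_derive; [repeat split; auto |].
  change (Derive (fun x0 => q x0) x) with (q' x).
  change (Derive (fun x0 => q' x0) x) with (q'' x).
  change (Derive (fun x0 => q'' x0) x) with (q''' x); ring.
Qed.

(** The arc length parametrization with t decreasing solves t' = - 1 / F(alpha'(t), 1). *)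
Lemma arclength_derive (a b eps delta : R) (alpha d1 t : R -> R) :
  0 <= a -> 0 <= b -> a + b = 1 ->
  (forall x, is_derive alpha x (d1 x)) ->
  is_arclength_parameter (minkowski a b) eps delta (gamma0 alpha) t ->
  forall s, Rabs s < delta -> is_derive t s (- / speed a b (d1 (t s))).
Proof.
intros Ha Hb Hab Hd [_ H] s Hs.
destruct (H s Hs) as (_ & (dt & Hdt & Hneg) & [v1 v2] & H1 & H2 & HF).
unfold gamma0 in H1, H2; cbn [fst snd] in H1, H2.
assert (E2 : v2 = dt).
{ rewrite <- (is_derive_unique _ _ _ H2), <- (is_derive_unique _ _ _ Hdt).
  apply Derive_ext; reflexivity. }
assert (E1 : v1 = dt * d1 (t s)).
{ rewrite <- (is_derive_unique _ _ _ H1); apply is_derive_unique.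
  apply (is_derive_comp alpha t); [apply Hd | assumption]. }
subst v1 v2; rewrite minkowski_vertical in HF by assumption.
pose proof (speed_ge1 a b (d1 (t s)) Ha Hb Hab) as H3.
replace (- / speed a b (d1 (t s))) with dt; [assumption |].
apply Rmult_eq_reg_r with (speed a b (d1 (t s))); [| lra].
replace (- / speed a b (d1 (t s)) * speed a b (d1 (t s))) with (-1) by (field; lra).
lra.
Qed.

Lemma continuous_bounded (f : R -> R) : continuous f 0 ->
  exists (K : R) (d : posreal), forall x, Rabs x < d -> Rabs (f x) <= K * Rabs x ^ 0.
Proof.
intros H.
assert (H' : locally (f 0) (fun y => Rabs (y - f 0) < 1)).
{ exists (mkposreal 1 Rlt_0_1); intros y Hy; exact Hy. }
destruct (H _ H') as [d Hd].
exists (Rabs (f 0) + 1), d; intros x Hx; simpl.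
assert (Hb : Rabs (f x - f 0) < 1).
{ apply Hd; change (Rabs (x - 0) < d); now rewrite Rminus_0_r. }
replace (f x) with ((f x - f 0) + f 0) by ring.
eapply Rle_trans; [apply Rabs_triang | lra].
Qed.

Lemma Ob_continuous_comp (f : R -> R) (g : R -> R -> R) :
  continuous f 0 -> Ob 1 g -> Ob 0 (fun s u => f (g s u)).
Proof.
intros Hf Hg; destruct (continuous_bounded f Hf) as (K & d & H).
apply (Ob_comp1 0 f g K d); [apply cond_pos | |]; assumption.
Qed.

(** Integration of an expansion in the first variable. *)
Lemma Ob_integrate (n : nat) (f df : R -> R) (d : R) :
  0 < d -> f 0 = 0 -> (forall x, Rabs x < d -> is_derive f x (df x)) ->
  Ob n (fun s _ => df s) -> Ob (S n) (fun s _ => f s).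
Proof.
intros Hd H0 Hf Hdf; destruct (Ob_elim _ _ Hdf) as (K & e & HK & _ & H).
pose proof (cond_pos e) as He.
apply (Ob_comp1 (S n) f (fun s _ => s) K (Rmin d e)); [| | apply Ob_fst].
- now apply Rmin_glb_lt.
- apply (derive_bound f df (Rmin d e) K n); try assumption.
  + intros x Hx; apply Hf, Rlt_le_trans with (1 := Hx), Rmin_l.
  + intros x Hx; replace (Rabs x) with (Rabs x + Rabs 0) by (rewrite Rabs_R0; ring).
    apply H; [apply Rlt_le_trans with (1 := Hx), Rmin_r | rewrite Rabs_R0; lra].
Qed.

(** Here t' = - 1 / speed; as |t'| <= 1, t = O(s), and each expansion of t' obtained
   from one of t is integrated to an expansion of t of higher order. *)
Lemma arclength_expansion (a b delta c1 c4 : R) (alpha d1 q0 q1 t : R -> R) :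
  0 <= a -> 0 <= b -> a + b = 1 -> 0 < delta ->
  continuous q0 0 -> continuous q1 0 ->
  (forall x, alpha x = c1 * x ^ 2 + c4 * x ^ 4 + x ^ 6 * q0 x) ->
  (forall x, d1 x = 2 * c1 * x + 4 * c4 * x ^ 3 + x ^ 5 * q1 x) ->
  t 0 = 0 ->
  (forall s, Rabs s < delta -> is_derive t s (- / speed a b (d1 (t s)))) ->
  let k := 2 * a * c1 ^ 2 / 3 in
  Ob 4 (fun s _ => t s - (- s + k * s ^ 3)) /\
  Ob 4 (fun s _ => - / speed a b (d1 (t s)) - (- 1 + 3 * k * s ^ 2)) /\
  Ob 4 (fun s _ => d1 (t s) - (- 2 * c1 * s + (2 * c1 * k - 4 * c4) * s ^ 3)) /\
  Ob 4 (fun s _ => alpha (t s) - c1 * s ^ 2).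
Proof.
intros Ha Hb Hab Hdelta Hq0 Hq1 Halpha Hd1 Ht0 Ht k.
set (G := fun s => - / speed a b (d1 (t s))).
assert (HG1 : forall s, Rabs (G s) <= 1).
{ intros s; unfold G; pose proof (speed_ge1 a b (d1 (t s)) Ha Hb Hab).
  rewrite Rabs_Ropp, Rabs_pos_eq by (left; apply Rinv_0_lt_compat; lra).
  rewrite <- Rinv_1; apply Rinv_le_contravar; lra. }
assert (HtO : Ob 1 (fun s _ => t s)).
{ apply (Ob_integrate 0 t G delta); try assumption.
  apply (Ob_intro _ _ 1 1); [lra |]; intros s u _ _; simpl.
  pose proof (HG1 s); lra. }
assert (Hq1O := Ob_continuous_comp q1 _ Hq1 HtO).
assert (Hq0O := Ob_continuous_comp q0 _ Hq0 HtO).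
cbv beta in Hq1O, Hq0O.
assert (Hd1O : Ob 4 (fun s _ => d1 (t s) - (2 * c1 * t s + 4 * c4 * t s ^ 3))).
{ apply Ob_ext with (fun s _ => t s ^ 5 * q1 (t s)); [intros s _; rewrite Hd1; ring | ob]. }
assert (Hd11 : Ob 1 (fun s _ => d1 (t s))).
{ apply (Ob_of_diff 1 _ (fun s _ => 2 * c1 * t s + 4 * c4 * t s ^ 3)); ob. }
assert (HGa : Ob 4 (fun s _ => G s - (- 1 + a / 2 * d1 (t s) ^ 2))).
{ apply (Ob_comp1 4 (fun x => - / speed a b x - (- 1 + a / 2 * x ^ 2))
    (fun s _ => d1 (t s)) 6 1); [lra | | assumption].
  intros x Hx; now apply inv_speed_expansion. }
assert (Hsq : Ob 4 (fun s _ => d1 (t s) ^ 2 - (2 * c1 * t s) ^ 2)).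
{ assert (H3 : Ob 3 (fun s _ => d1 (t s) - 2 * c1 * t s)).
  { apply Ob_ext with (fun s _ =>
      (d1 (t s) - (2 * c1 * t s + 4 * c4 * t s ^ 3)) + 4 * c4 * t s ^ 3);
    [intros; ring | ob]. }
  apply Ob_ext with (fun s _ =>
    (d1 (t s) - 2 * c1 * t s) * (d1 (t s) + 2 * c1 * t s)); [intros; ring | ob]. }
assert (HGt : Ob 4 (fun s _ => G s - (- 1 + 3 * k * t s ^ 2))).
{ apply Ob_ext with (fun s _ =>
    (G s - (- 1 + a / 2 * d1 (t s) ^ 2)) + a / 2 * (d1 (t s) ^ 2 - (2 * c1 * t s) ^ 2));
  [intros; unfold k; field | ob]. }
assert (HG2 : Ob 2 (fun s _ => G s + 1)).
{ apply Ob_ext with (fun s _ => (G s - (- 1 + 3 * k * t s ^ 2)) + 3 * k * t s ^ 2);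
  [intros; ring | ob]. }
assert (Ht3 : Ob 3 (fun s _ => t s + s)).
{ apply (Ob_integrate 2 (fun s => t s + s) (fun s => G s + 1) delta); try assumption.
  - rewrite Ht0; ring.
  - intros x Hx; apply (is_derive_plus t (fun y => y)); [now apply Ht |].
    auto_derive; trivial. }
assert (HGs : Ob 4 (fun s _ => G s - (- 1 + 3 * k * s ^ 2))).
{ apply Ob_ext with (fun s _ =>
    (G s - (- 1 + 3 * k * t s ^ 2)) + 3 * k * ((t s + s) * (t s - s)));
  [intros; ring | ob]. }
assert (Ht4 : Ob 4 (fun s _ => t s - (- s + k * s ^ 3))).
{ apply (Ob_le 4 5); [lia |].
  apply (Ob_integrate 4 (fun s => t s - (- s + k * s ^ 3))
    (fun s => G s - (- 1 + 3 * k * s ^ 2)) delta); try assumption.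
  - rewrite Ht0; ring.
  - intros x Hx; apply (is_derive_minus t (fun y => - y + k * y ^ 3)); [now apply Ht |].
    auto_derive; [trivial | ring]. }
repeat split; try assumption.
- apply Ob_ext with (fun s _ => (d1 (t s) - (2 * c1 * t s + 4 * c4 * t s ^ 3))
    + 2 * c1 * (t s - (- s + k * s ^ 3))
    + 4 * c4 * ((t s + s) * (t s ^ 2 - t s * s + s ^ 2))); [intros; ring | ob].
- apply Ob_ext with (fun s _ => c1 * ((t s + s) * (t s - s)) + c4 * t s ^ 4
    + t s ^ 6 * q0 (t s)); [intros; rewrite Halpha; ring | ob].
Qed.

(** * The radius of curvature *)

(** The terms with t'' cancel: the curvature does not depend on the
   parametrization. *)
Lemma radius_of_curvature_graph (alpha d1 d2 t G : R -> R) (delta s : R) :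
  (forall x, is_derive alpha x (d1 x)) -> (forall x, is_derive d1 x (d2 x)) ->
  (forall r, Rabs r < delta -> is_derive t r (G r)) ->
  (forall r, Rabs r < delta -> ex_derive G r) -> (forall r, G r < 0) ->
  Rabs s < delta -> d2 (t s) <> 0 ->
  radius_of_curvature (fun r => gamma0 alpha (t r)) s =
    sqrt (1 + d1 (t s) ^ 2) ^ 3 / Rabs (d2 (t s)).
Proof.
intros Ha Hd1 Ht HG HGneg Hs Hd2.
assert (HL : locally s (fun r => Rabs r < delta)).
{ assert (He : 0 < delta - Rabs s) by lra.
  exists (mkposreal _ He); intros r Hr; change (Rabs (r - s) < delta - Rabs s) in Hr.
  replace r with ((r - s) + s) by ring; eapply Rle_lt_trans; [apply Rabs_triang | lra]. }
set (x := fun r => alpha (t r)).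
assert (Hx : forall r, Rabs r < delta -> is_derive x r (d1 (t r) * G r)).
{ intros r Hr; rewrite Rmult_comm; apply (is_derive_comp alpha t); [apply Ha | auto]. }
destruct (HG s Hs) as [dG HdG].
assert (Hx2 : Derive_n x 2 s = d2 (t s) * G s ^ 2 + d1 (t s) * dG).
{ change (Derive_n x 2 s) with (Derive (Derive x) s).
  rewrite (Derive_ext_loc _ (fun r => d1 (t r) * G r)).
  2:{ revert HL; apply filter_imp; intros r Hr; apply is_derive_unique; auto. }
  apply is_derive_unique.
  replace (d2 (t s) * G s ^ 2 + d1 (t s) * dG)
    with (G s * d2 (t s) * G s + d1 (t s) * dG) by ring.
  apply (is_derive_mult (fun r => d1 (t r)) G); [| assumption | apply Rmult_comm].
  apply (is_derive_comp d1 t); auto. }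
assert (Ht2 : Derive_n t 2 s = dG).
{ change (Derive_n t 2 s) with (Derive (Derive t) s).
  rewrite (Derive_ext_loc _ G); [now apply is_derive_unique |].
  revert HL; apply filter_imp; intros r Hr; apply is_derive_unique; auto. }
unfold radius_of_curvature, gamma0; cbn [fst snd].
change (Derive_n (fun r => alpha (t r)) 2 s) with (Derive_n x 2 s).
change (Derive_n (fun r => t r) 2 s) with (Derive_n t 2 s).
replace (Derive (fun r => alpha (t r)) s) with (d1 (t s) * G s)
  by (symmetry; apply is_derive_unique; auto).
replace (Derive (fun r => t r) s) with (G s)
  by (symmetry; apply is_derive_unique; auto).
rewrite Hx2, Ht2.
replace (d1 (t s) * G s * dG - G s * (d2 (t s) * G s ^ 2 + d1 (t s) * dG))
  with (d2 (t s) * (- G s) ^ 3) by ring.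
replace ((d1 (t s) * G s) ^ 2 + G s ^ 2) with ((- G s) ^ 2 * (1 + d1 (t s) ^ 2)) by ring.
specialize (HGneg s).
rewrite sqrt_mult_alt by apply pow2_ge_0.
rewrite sqrt_pow2 by lra.
rewrite Rabs_mult, (Rabs_pos_eq ((- G s) ^ 3)) by (apply pow_le; lra).
field; split; [now apply Rabs_no_R0 | lra].
Qed.

(** As the curvature is an even function of t to second order and t'(0) = - 1, the
   second derivative with respect to s is the one with respect to t. *)
Lemma radius_of_curvature_second_derivative
    (alpha d1 d2 d3 t G : R -> R) (delta c1 c4 : R) :
  (forall x, is_derive alpha x (d1 x)) -> (forall x, is_derive d1 x (d2 x)) ->
  (forall x, is_derive d2 x (d3 x)) -> is_derive d3 0 (24 * c4) ->
  (forall r, Rabs r < delta -> is_derive t r (G r)) ->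
  (forall r, Rabs r < delta -> ex_derive G r) -> (forall r, G r < 0) ->
  0 < delta -> 0 < c1 -> t 0 = 0 -> G 0 = -1 ->
  d1 0 = 0 -> d2 0 = 2 * c1 -> d3 0 = 0 ->
  radius_of_curvature (fun r => gamma0 alpha (t r)) 0 = / (2 * c1) /\
  Derive_n (radius_of_curvature (fun r => gamma0 alpha (t r))) 2 0 =
    6 * c1 - 6 * c4 / c1 ^ 2.
Proof.
intros Ha Hd1 Hd2 Hd3 Ht HG HGneg Hdelta Hc1 Ht0 HG0 E1 E2 E3.
assert (H0 : Rabs 0 < delta) by (rewrite Rabs_R0; lra).
split.
{ rewrite (radius_of_curvature_graph alpha d1 d2 t G delta); try assumption;
    rewrite Ht0, ?E1, E2; [| lra].
  replace (1 + 0 ^ 2) with 1 by ring; rewrite sqrt_1, Rabs_pos_eq by lra; field; lra. }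
assert (HL : locally 0 (fun s => Rabs s < delta /\ 0 < d2 (t s))).
{ apply filter_and.
  - exists (mkposreal _ Hdelta); intros r Hr; change (Rabs (r - 0) < delta) in Hr.
    now rewrite Rminus_0_r in Hr.
  - assert (Hc : continuous (fun s => d2 (t s)) 0).
    { apply (ex_derive_continuous (V := R_NormedModule)).
      exists (G 0 * d3 (t 0)); apply (is_derive_comp d2 t); auto. }
    apply Hc.
    rewrite Ht0, E2; assert (Hc2 : 0 < 2 * c1) by lra.
    exists (mkposreal _ Hc2); intros y Hy; change (Rabs (y - 2 * c1) < 2 * c1) in Hy.
    apply Rabs_def2 in Hy; lra. }
set (rho := fun x => sqrt (1 + d1 x ^ 2) ^ 3 / d2 x).
set (rho1 := fun x => (3 * sqrt (1 + d1 x ^ 2) * d1 x * d2 x ^ 2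
  - sqrt (1 + d1 x ^ 2) ^ 3 * d3 x) / d2 x ^ 2).
assert (Hw : forall x, 1 <= sqrt (1 + d1 x ^ 2)).
{ intros x; apply sqrt_ge1; pose proof (pow2_ge_0 (d1 x)); lra. }
assert (Hrho : forall x, 0 < d2 x -> is_derive rho x (rho1 x)).
{ intros x Hx; unfold rho, rho1; auto_derive.
  - repeat split; try (eexists; eauto); [| lra].
    pose proof (pow2_ge_0 (d1 x)); simpl in *; lra.
  - replace (Derive (fun x0 => d1 x0) x) with (d2 x) by (symmetry; apply is_derive_unique, Hd1).
    replace (Derive (fun x0 => d2 x0) x) with (d3 x) by (symmetry; apply is_derive_unique, Hd2).
    replace (1 + d1 x * (d1 x * 1)) with (1 + d1 x ^ 2) by ring.
    specialize (Hw x); field; split; lra. }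
assert (Hrho1 : is_derive rho1 0 (6 * c1 - 6 * c4 / c1 ^ 2)).
{ unfold rho1; auto_derive.
  - repeat split; try (eexists; eauto).
    + rewrite E1; lra.
    + rewrite E1; lra.
    + rewrite E2; nra.
  - replace (Derive (fun x0 => d1 x0) 0) with (d2 0) by (symmetry; apply is_derive_unique, Hd1).
    replace (Derive (fun x0 => d2 x0) 0) with (d3 0) by (symmetry; apply is_derive_unique, Hd2).
    replace (Derive (fun x0 => d3 x0) 0) with (24 * c4) by (symmetry; now apply is_derive_unique).
    rewrite E1, E2, E3.
    replace (1 + 0 * (0 * 1)) with 1 by ring; rewrite sqrt_1; field; lra. }
assert (HR : forall s, Rabs s < delta -> 0 < d2 (t s) ->
  radius_of_curvature (fun r => gamma0 alpha (t r)) s = rho (t s)).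
{ intros s Hs Hp; rewrite (radius_of_curvature_graph alpha d1 d2 t G delta);
    try assumption; [| lra].
  unfold rho; now rewrite Rabs_pos_eq by lra. }
assert (HR1 : locally 0 (fun s => Derive (radius_of_curvature (fun r => gamma0 alpha (t r))) s
   = rho1 (t s) * G s)).
{ apply locally_locally in HL; revert HL; apply filter_imp; intros s Hs.
  assert (Hs0 := locally_singleton _ _ Hs).
  rewrite (Derive_ext_loc _ (fun r => rho (t r))).
  - apply is_derive_unique; rewrite Rmult_comm; destruct Hs0.
    apply (is_derive_comp rho t); auto.
  - revert Hs; apply filter_imp; intros r [Hr1 Hr2]; auto. }
change (Derive (Derive (radius_of_curvature (fun r => gamma0 alpha (t r)))) 0 =
  6 * c1 - 6 * c4 / c1 ^ 2).
rewrite (Derive_ext_loc _ _ _ HR1).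
destruct (HG 0 H0) as [dG HdG].
apply is_derive_unique.
replace (6 * c1 - 6 * c4 / c1 ^ 2) with
  (G 0 * (6 * c1 - 6 * c4 / c1 ^ 2) * G 0 + rho1 (t 0) * dG).
2:{ rewrite Ht0, HG0; unfold rho1; rewrite E1, E3; field; rewrite ?E2; lra. }
apply (is_derive_mult (fun r => rho1 (t r)) G); [| assumption | apply Rmult_comm].
apply (is_derive_comp rho1 t); [now rewrite Ht0 | auto].
Qed.

(** * The billiard map near the periodic orbit *)

(** The slope of the ray from the point of [gamma0] of arc length parameter s to the
   point of [gamma1] of arc length parameter v. *)
Definition slope (L : R) (alpha t : R -> R) (s v : R) : R :=
  - (t s + t v) / (L - alpha (t s) - alpha (t v)).

(** The derivative with respect to s of the F-distance between these points, see
   [is_derive_distance]. *)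
Definition phase (a b L : R) (alpha d1 t : R -> R) (s v : R) : R :=
  / speed a b (d1 (t s)) *
  (d1 (t s) * Phi0 a b (slope L alpha t s v) + Phi1 a b (slope L alpha t s v)).

(** [quartic_d1 e1 e2 e3] is the derivative with respect to its first argument of
   the quartic form e1 (x^4 + y^4) + e2 (x^3 y + x y^3) + e3 x^2 y^2. *)
Definition quartic_d1 (e1 e2 e3 x y : R) : R :=
  4 * e1 * x ^ 3 + e2 * (3 * x ^ 2 * y + y ^ 3) + 2 * e3 * x * y ^ 2.

Lemma is_derive_distance (a b L : R) (alpha d1 t : R -> R) (s v : R) :
  (forall x, is_derive alpha x (d1 x)) ->
  is_derive t s (- / speed a b (d1 (t s))) ->
  0 < L - alpha (t s) - alpha (t v) ->
  is_derive (fun x => minkowski a b (L - alpha (t v) - alpha (t x), - t v - t x)) s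
    (phase a b L alpha d1 t s v).
Proof.
intros Hd Ht HX.
set (dt := - / speed a b (d1 (t s))) in *.
replace (phase a b L alpha d1 t s v) with
  (Phi0 a b ((- t v - t s) / (L - alpha (t v) - alpha (t s))) * (- (d1 (t s) * dt)) +
   Phi1 a b ((- t v - t s) / (L - alpha (t v) - alpha (t s))) * (- dt)).
2:{ unfold phase, slope.
  replace (- (t s + t v)) with (- t v - t s) by ring.
  replace (L - alpha (t s) - alpha (t v)) with (L - alpha (t v) - alpha (t s)) by ring.
  unfold dt; ring. }
apply (is_derive_minkowski a b (fun x => L - alpha (t v) - alpha (t x))
  (fun x => - t v - t x)); [lra | |].
- auto_derive.
  + split; [eexists; apply Hd | split; [eexists; eassumption | trivial]].
  + replace (Derive (fun x => alpha x) (t s)) with (d1 (t s))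
      by (symmetry; apply is_derive_unique, Hd).
    replace (Derive (fun x => t x) s) with dt
      by (symmetry; now apply is_derive_unique).
    ring.
- auto_derive.
  + eexists; eassumption.
  + replace (Derive (fun x => t x) s) with dt
      by (symmetry; now apply is_derive_unique).
    ring.
Qed.

(** The coefficients c1, c4 are those of t^2 and t^4 in alpha, and k is the one of
   s^3 in t(s). *)
Lemma phase_expansion (a b L c1 c4 k : R) (alpha d1 t : R -> R) :
  0 <= a -> 0 <= b -> a + b = 1 -> 0 < L ->
  k = 2 * a * c1 ^ 2 / 3 ->
  Ob 4 (fun s _ => t s - (- s + k * s ^ 3)) ->
  Ob 4 (fun s _ => - / speed a b (d1 (t s)) - (- 1 + 3 * k * s ^ 2)) ->
  Ob 4 (fun s _ => d1 (t s) - (- 2 * c1 * s + (2 * c1 * k - 4 * c4) * s ^ 3)) ->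
  Ob 4 (fun s _ => alpha (t s) - c1 * s ^ 2) ->
  Ob 4 (fun s v => phase a b L alpha d1 t s v -
    (- 2 * c1 * s + a / L * (s + v) +
     quartic_d1
       (2 * c1 * k - c4 + a * c1 / (2 * L ^ 2) - a * k / L + (2 * b - a) / (8 * L ^ 3))
       (a * c1 / L ^ 2 - a * k / L + (2 * b - a) / (2 * L ^ 3))
       (a * c1 / L ^ 2 + 3 * (2 * b - a) / (4 * L ^ 3)) s v)).
Proof.
intros Ha Hb Hab HL Hk Ht HG Hd Hal.
assert (Ht' := Ob_swap _ _ Ht); assert (Hal' := Ob_swap _ _ Hal); cbv beta in Ht', Hal'.
assert (Ht1 : Ob 1 (fun s _ => t s)).
{ apply (Ob_of_diff 1 _ (fun s _ => - s + k * s ^ 3)); ob. }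
assert (Ht1' := Ob_swap _ _ Ht1); cbv beta in Ht1'.
assert (HD1 : Ob 1 (fun s v => d1 (t s))).
{ apply (Ob_of_diff 1 _ (fun s _ => - 2 * c1 * s + (2 * c1 * k - 4 * c4) * s ^ 3)); ob. }
(* L - w is the horizontal distance between the two points. *)
set (w := fun s v => alpha (t s) + alpha (t v)).
assert (Hw : Ob 4 (fun s v => w s v - c1 * (s ^ 2 + v ^ 2))).
{ apply Ob_ext with (fun s v => (alpha (t s) - c1 * s ^ 2) + (alpha (t v) - c1 * v ^ 2));
  [intros; unfold w; ring | ob]. }
assert (Hw2 : Ob 2 (fun s v => w s v)).
{ apply (Ob_of_diff 2 _ (fun s v => c1 * (s ^ 2 + v ^ 2))); ob. }
assert (Hh : Ob 0 (fun s v => / (L - w s v))).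
{ apply (Ob_continuous_comp (fun x => / (L - x)) w).
  - apply (ex_derive_continuous (V := R_NormedModule)); auto_derive; lra.
  - apply (Ob_le 1 2); [lia | assumption]. }
assert (Hne : locally_2d (fun s v => L - w s v <> 0) 0 0).
{ generalize (Ob_small w L HL (Ob_le 1 2 _ ltac:(lia) Hw2)).
  apply locally_2d_impl, locally_2d_forall; intros s v H.
  pose proof (Rle_abs (w s v)); lra. }
set (mu := slope L alpha t).
set (mu1 := fun s v => (s + v) / L).
set (mu3 := fun s v => - k * (s ^ 3 + v ^ 3) / L + (s + v) * (c1 * (s ^ 2 + v ^ 2)) / L ^ 2).
assert (Hmu : Ob 4 (fun s v => mu s v - (mu1 s v + mu3 s v))).
{ apply Ob_ext_loc with (fun s v =>
    - (t s + t v) * (w s v * w s v * / (L - w s v)) / L ^ 2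
    - ((t s - (- s + k * s ^ 3)) + (t v - (- v + k * v ^ 3))) * (/ L + w s v / L ^ 2)
    + (s + v) * (w s v - c1 * (s ^ 2 + v ^ 2)) / L ^ 2
    - k * (s ^ 3 + v ^ 3) * w s v / L ^ 2); [| ob].
  revert Hne; apply locally_2d_impl, locally_2d_forall; intros s v H.
  unfold mu, mu1, mu3, slope; fold (w s v).
  replace (L - alpha (t s) - alpha (t v)) with (L - w s v) by (unfold w; ring).
  field; split; lra. }
assert (Hmu1 : Ob 1 (fun s v => mu1 s v)) by (unfold mu1; ob).
assert (Hmu3 : Ob 3 (fun s v => mu3 s v)) by (unfold mu3; ob).
assert (HmuO : Ob 1 (fun s v => mu s v)).
{ apply (Ob_of_diff 1 _ (fun s v => mu1 s v + mu3 s v)); ob. }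
assert (HmuD : Ob 3 (fun s v => mu s v - mu1 s v)).
{ apply Ob_ext with (fun s v => (mu s v - (mu1 s v + mu3 s v)) + mu3 s v);
  [intros; ring | ob]. }
assert (HP0 : Ob 4 (fun s v => Phi0 a b (mu s v) - (1 - a / 2 * mu1 s v ^ 2))).
{ assert (H : Ob 4 (fun s v => Phi0 a b (mu s v) - (1 - a / 2 * mu s v ^ 2))).
  { apply (Ob_comp1 4 (fun m => Phi0 a b m - (1 - a / 2 * m ^ 2)) mu 1 1); [lra | | assumption].
    intros; now apply Phi0_expansion. }
  apply Ob_ext with (fun s v => (Phi0 a b (mu s v) - (1 - a / 2 * mu s v ^ 2))
    - a / 2 * ((mu s v - mu1 s v) * (mu s v + mu1 s v))); [intros; ring | ob]. }
assert (HP1 : Ob 4 (fun s v => Phi1 a b (mu s v) -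
  (a * (mu1 s v + mu3 s v) + (b - a / 2) * mu1 s v ^ 3))).
{ assert (H : Ob 4 (fun s v => Phi1 a b (mu s v) - (a * mu s v + (b - a / 2) * mu s v ^ 3))).
  { apply (Ob_comp1 4 (fun m => Phi1 a b m - (a * m + (b - a / 2) * m ^ 3)) mu 1 1);
      [lra | | assumption].
    intros; now apply Phi1_expansion. }
  apply Ob_ext with (fun s v => (Phi1 a b (mu s v) - (a * mu s v + (b - a / 2) * mu s v ^ 3))
    + a * (mu s v - (mu1 s v + mu3 s v))
    + (b - a / 2) * ((mu s v - mu1 s v) * (mu s v ^ 2 + mu s v * mu1 s v + mu1 s v ^ 2)));
    [intros; ring | ob]. }
set (A3 := 2 * c1 * k - 4 * c4) in *.
assert (HB : Ob 4 (fun s v => d1 (t s) * Phi0 a b (mu s v) -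
  (- 2 * c1 * s + A3 * s ^ 3 + a * c1 * s * mu1 s v ^ 2))).
{ apply Ob_ext with (fun s v =>
    d1 (t s) * (Phi0 a b (mu s v) - (1 - a / 2 * mu1 s v ^ 2))
    + (d1 (t s) - (- 2 * c1 * s + A3 * s ^ 3)) * (1 - a / 2 * mu1 s v ^ 2)
    - a / 2 * (A3 * s ^ 3 * mu1 s v ^ 2)); [intros; field | ob]. }
assert (HB1 : Ob 4 (fun s v => d1 (t s) * Phi0 a b (mu s v) + Phi1 a b (mu s v) -
  ((- 2 * c1 * s + a * mu1 s v) +
   (A3 * s ^ 3 + a * c1 * s * mu1 s v ^ 2 + a * mu3 s v + (b - a / 2) * mu1 s v ^ 3)))).
{ apply Ob_ext with (fun s v =>
   (d1 (t s) * Phi0 a b (mu s v) - (- 2 * c1 * s + A3 * s ^ 3 + a * c1 * s * mu1 s v ^ 2))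
   + (Phi1 a b (mu s v) - (a * (mu1 s v + mu3 s v) + (b - a / 2) * mu1 s v ^ 3)));
   [intros; ring | ob]. }
set (B1 := fun s v => - 2 * c1 * s + a * mu1 s v).
set (B3 := fun s v => A3 * s ^ 3 + a * c1 * s * mu1 s v ^ 2 + a * mu3 s v
  + (b - a / 2) * mu1 s v ^ 3).
set (B := fun s v => d1 (t s) * Phi0 a b (mu s v) + Phi1 a b (mu s v)).
assert (HB' : Ob 4 (fun s v => B s v - (B1 s v + B3 s v))) by exact HB1.
assert (HB1O : Ob 1 (fun s v => B1 s v)) by (unfold B1; ob).
assert (HB3O : Ob 3 (fun s v => B3 s v)) by (unfold B3; ob).
assert (HBO : Ob 1 (fun s v => B s v)).
{ apply (Ob_of_diff 1 _ (fun s v => B1 s v + B3 s v)); ob. }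
apply Ob_ext with (fun s v =>
  - (- / speed a b (d1 (t s)) - (- 1 + 3 * k * s ^ 2)) * B s v
  + (1 - 3 * k * s ^ 2) * (B s v - (B1 s v + B3 s v))
  - 3 * k * s ^ 2 * B3 s v); [| ob].
intros s v; unfold phase; fold (mu s v); fold (B s v).
unfold B1, B3, A3, mu1, mu3, quartic_d1; rewrite Hk; field.
split; [lra |]; pose proof (speed_ge1 a b (d1 (t s)) Ha Hb Hab); lra.
Qed.

Lemma continuous_fst_small (T : R * R -> R * R) (e : R) :
  0 < e -> T (0, 0) = (0, 0) -> continuous T (0, 0) ->
  locally_2d (fun s u => Rabs s < e /\ Rabs (fst (T (s, u))) < e) 0 0.
Proof.
intros He HT0 HTc; apply locally_2d_and.
- exists (mkposreal e He); intros s u; now rewrite Rminus_0_r.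
- apply locally_2d_locally.
  assert (Hb : locally (T (0, 0)) (fun z => Rabs (fst z) < e)).
  { rewrite HT0; exists (mkposreal e He); intros [x y] [Hx _]; cbn [fst] in *.
    change (Rabs (x - 0) < e) in Hx; now rewrite Rminus_0_r in Hx. }
  apply (filter_imp (fun z => Rabs (fst (T z)) < e));
    [intros [x y]; auto | exact (HTc _ Hb)].
Qed.

(** By the reflection law u1 only depends on the incoming ray, so that the next
   impact s2 disappears; by symmetry of the distance u1 is again given by [phase]. *)
Lemma billiard_phase (a b L delta : R) (alpha d1 t : R -> R) (T : R * R -> R * R) :
  0 < L ->
  (forall x, is_derive alpha x (d1 x)) ->
  (forall s, Rabs s < delta -> is_derive t s (- / speed a b (d1 (t s)))) ->
  Ob 2 (fun s _ => alpha (t s)) ->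
  is_one_step_billiard_map (minkowski a b) delta
    (fun s => gamma0 alpha (t s)) (fun s => gamma1 L alpha (t s)) T ->
  locally_2d (fun s u =>
    u = phase a b L alpha d1 t s (fst (T (s, u))) /\
    snd (T (s, u)) = - phase a b L alpha d1 t (fst (T (s, u))) s) 0 0.
Proof.
intros HL Hd Ht Hal (HT0 & HTc & HT).
assert (Hpos : exists e : posreal, forall s v, Rabs s < e -> Rabs v < e ->
  0 < L - alpha (t s) - alpha (t v)).
{ assert (Hw : Ob 1 (fun s v => alpha (t s) + alpha (t v))).
  { assert (Hal' := Ob_swap _ _ Hal); cbv beta in Hal'; ob. }
  destruct (Ob_small _ L HL Hw) as [e He]; exists e; intros s v Hs Hv.
  specialize (He s v); rewrite !Rminus_0_r in He; specialize (He Hs Hv).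
  pose proof (Rle_abs (alpha (t s) + alpha (t v))); lra. }
destruct Hpos as [e He].
generalize (locally_2d_and _ _ _ _ (continuous_fst_small T e (cond_pos e) HT0 HTc) HT).
apply locally_2d_impl, locally_2d_forall; intros s u [[Hse Hs1e] H].
unfold one_step_billiard in H.
destruct (T (s, u)) as [s1 u1]; cbn [fst snd] in *.
destruct H as (Hsd & Hs1d & Hu & s2 & Hs2 & Hr & Hu1).
split.
- rewrite <- (is_derive_unique _ _ _ Hu).
  apply (is_derive_unique (fun x => minkowski a b (L - alpha (t s1) - alpha (t x), - t s1 - t x))).
  apply is_derive_distance; auto.
- assert (H1 := is_derive_minus _ _ _ _ _ Hr Hu1).
  assert (E := is_derive_unique _ _ _ H1).
  rewrite (is_derive_unique _ s1 (phase a b L alpha d1 t s1 s)) in E.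
  { unfold minus, plus, opp in E; simpl in E; lra. }
  apply is_derive_ext with
    (fun x => minkowski a b (L - alpha (t s) - alpha (t x), - t s - t x)).
  + intros x; unfold minus, plus, opp; simpl.
    unfold vminus, gamma0, gamma1; cbn [fst snd].
    replace (L - alpha (t x) - alpha (t s)) with (L - alpha (t s) - alpha (t x)) by ring.
    replace (- t x - t s) with (- t s - t x) by ring; ring.
  + apply is_derive_distance; auto.
Qed.

(** A continuous solution s1 of u = phi(s, s1) is O(|s| + |u|): near the origin the
   nonlinear part of phi is absorbed by half of the linear part. *)
Lemma implicit_map_order (phi : R -> R -> R) (kap cc : R) (T : R * R -> R * R) :
  0 < kap -> T (0, 0) = (0, 0) -> continuous T (0, 0) ->
  Ob 3 (fun s v => phi s v - kap * (v - cc * s)) ->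
  locally_2d (fun s u => u = phi s (fst (T (s, u)))) 0 0 ->
  Ob 1 (fun s u => fst (T (s, u))).
Proof.
intros Hk HT0 HTc Hphi Hloc.
destruct (Ob_elim _ _ Hphi) as (K & d & HK & Hd1 & H).
set (e := Rmin (d / 2) (kap / (4 * (K + 1)))).
assert (He0 : 0 < kap / (4 * (K + 1))) by (apply Rdiv_lt_0_compat; lra).
pose proof (cond_pos d) as Hd.
assert (He : 0 < e) by (apply Rmin_glb_lt; lra).
exists (2 * (Rabs cc + / 2 + / kap)).
generalize (locally_2d_and _ _ _ _ (continuous_fst_small T e He HT0 HTc) Hloc).
apply locally_2d_impl, locally_2d_forall; intros s u [[Hs Hv] E].
set (v := fst (T (s, u))) in *.
assert (Hed : e <= d / 2) by apply Rmin_l.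
assert (Hek : e <= kap / (4 * (K + 1))) by apply Rmin_r.
specialize (H s v ltac:(lra) ltac:(lra)); rewrite <- E in H.
set (r := Rabs s + Rabs v) in *.
assert (Hr : 0 <= r) by apply sum_abs_ge0.
assert (Hr1 : r <= 1) by (unfold r; lra).
assert (HKr : K * r <= kap / 2).
{ apply Rle_trans with ((K + 1) * (2 * (kap / (4 * (K + 1))))).
  - apply Rmult_le_compat; unfold r in *; lra.
  - right; field; lra. }
assert (HK3 : K * r ^ 3 <= kap / 2 * r).
{ replace (K * r ^ 3) with (K * r * (r * r)) by ring.
  apply Rmult_le_compat; nra. }
assert (Hv' : v = cc * s + / kap * u - / kap * (u - kap * (v - cc * s))) by (field; lra).
assert (Hki : 0 < / kap) by now apply Rinv_0_lt_compat.
assert (Hvb : Rabs v <= Rabs cc * Rabs s + / kap * Rabs u + / kap * (kap / 2 * r)).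
{ rewrite Hv' at 1.
  eapply Rle_trans; [apply Rabs_triang |]; apply Rplus_le_compat.
  - eapply Rle_trans; [apply Rabs_triang |].
    rewrite !Rabs_mult, (Rabs_pos_eq (/ kap)) by lra; lra.
  - rewrite Rabs_Ropp, Rabs_mult, (Rabs_pos_eq (/ kap)) by lra.
    apply Rmult_le_compat_l; lra. }
replace (/ kap * (kap / 2 * r)) with (r / 2) in Hvb by (field; lra).
pose proof (Rabs_pos s); pose proof (Rabs_pos u); pose proof (Rabs_pos cc).
unfold r in Hvb; rewrite pow_1.
assert (0 <= Rabs cc * Rabs u) by (apply Rmult_le_pos; assumption).
assert (0 <= / kap * Rabs s) by (apply Rmult_le_pos; lra).
nra.
Qed.

(** The third order expansion of a map with symmetric generating function
   kap (s v - cc (s^2 + v^2) / 2) + (quartic form), of which [phi] is the derivative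
   with respect to s, up to order 4. *)
Lemma implicit_map_expansion (phi : R -> R -> R) (kap cc e1 e2 e3 : R)
    (T : R * R -> R * R) :
  0 < kap -> T (0, 0) = (0, 0) -> continuous T (0, 0) ->
  Ob 4 (fun s v => phi s v - (kap * (v - cc * s) + quartic_d1 e1 e2 e3 s v)) ->
  locally_2d (fun s u => u = phi s (fst (T (s, u))) /\
    snd (T (s, u)) = - phi (fst (T (s, u))) s) 0 0 ->
  Ob 4 (fun s u => fst (T (s, u)) -
    (cc * s + u / kap - quartic_d1 e1 e2 e3 s (cc * s + u / kap) / kap)) /\
  Ob 4 (fun s u => snd (T (s, u)) -
    (kap * (cc * (cc * s + u / kap) - s)
     - cc * quartic_d1 e1 e2 e3 s (cc * s + u / kap)
     - quartic_d1 e1 e2 e3 (cc * s + u / kap) s)).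
Proof.
intros Hk HT0 HTc Hphi Hloc.
set (Q := quartic_d1 e1 e2 e3) in *.
assert (HQ : Ob 3 (fun s v => Q s v)) by (unfold Q, quartic_d1; ob).
assert (Hphi3 : Ob 3 (fun s v => phi s v - kap * (v - cc * s))).
{ apply Ob_ext with (fun s v => (phi s v - (kap * (v - cc * s) + Q s v)) + Q s v);
  [intros; ring | ob]. }
set (v := fun s u => fst (T (s, u))).
set (vb := fun s u => cc * s + u / kap).
assert (Hv : Ob 1 (fun s u => v s u)).
{ apply (implicit_map_order phi kap cc T); try assumption.
  revert Hloc; apply locally_2d_impl, locally_2d_forall; intros s u [E _]; exact E. }
assert (Hvb : Ob 1 (fun s u => vb s u)) by (unfold vb; ob).
assert (HC := Ob_comp _ _ _ _ Hphi Ob_fst Hv).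
assert (HC' := Ob_comp _ _ _ _ Hphi Hv Ob_fst).
assert (HC3 := Ob_comp _ _ _ _ Hphi3 Ob_fst Hv).
cbv beta in HC, HC', HC3.
assert (Hv3 : Ob 3 (fun s u => v s u - vb s u)).
{ apply Ob_ext_loc with (fun s u => (- / kap) * (phi s (v s u) - kap * (v s u - cc * s)));
    [| ob].
  revert Hloc; apply locally_2d_impl, locally_2d_forall; intros s u [E _].
  fold (v s u) in E; unfold vb; rewrite <- E; field; lra. }
assert (HQd : Ob 4 (fun s u => Q s (v s u) - Q s (vb s u))).
{ apply Ob_ext with (fun s u => (v s u - vb s u) *
   (e2 * (3 * s ^ 2 + v s u ^ 2 + v s u * vb s u + vb s u ^ 2)
    + 2 * e3 * s * (v s u + vb s u))); [intros; unfold Q, quartic_d1; ring | ob]. }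
assert (HQd' : Ob 4 (fun s u => Q (v s u) s - Q (vb s u) s)).
{ apply Ob_ext with (fun s u => (v s u - vb s u) *
   (4 * e1 * (v s u ^ 2 + v s u * vb s u + vb s u ^ 2)
    + 3 * e2 * s * (v s u + vb s u) + 2 * e3 * s ^ 2));
  [intros; unfold Q, quartic_d1; ring | ob]. }
assert (Hv4 : Ob 4 (fun s u => v s u - (vb s u - Q s (vb s u) / kap))).
{ apply Ob_ext_loc with (fun s u =>
    (- / kap) * (phi s (v s u) - (kap * (v s u - cc * s) + Q s (v s u)))
    - (Q s (v s u) - Q s (vb s u)) / kap); [| ob].
  revert Hloc; apply locally_2d_impl, locally_2d_forall; intros s u [E _].
  fold (v s u) in E; unfold vb; rewrite <- E; field; lra. }
split; [exact Hv4 |].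
apply Ob_ext_loc with (fun s u =>
  - (phi (v s u) s - (kap * (s - cc * v s u) + Q (v s u) s))
  + kap * cc * (v s u - (vb s u - Q s (vb s u) / kap))
  - (Q (v s u) s - Q (vb s u) s)); [| ob].
revert Hloc; apply locally_2d_impl, locally_2d_forall; intros s u [_ E].
fold (v s u) in E; rewrite E; unfold vb; field; lra.
Qed.

(** * Ellipticity *)

Lemma Ob_differentiable (f : R -> R -> R) (lx ly : R) : f 0 0 = 0 ->
  Ob 2 (fun s u => f s u - (lx * s + ly * u)) -> differentiable_pt_lim f 0 0 lx ly.
Proof.
intros H0 HO eps; destruct (Ob_elim _ _ HO) as (K & d & HK & _ & H).
pose proof (cond_pos eps) as Heps.
set (e := Rmin d (eps / (4 * (K + 1)))).
assert (He : 0 < e).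
{ apply Rmin_glb_lt; [apply cond_pos | apply Rdiv_lt_0_compat; lra]. }
exists (mkposreal e He); simpl; intros s u; rewrite !Rminus_0_r, H0, Rminus_0_r.
intros Hs Hu.
assert (He1 : e <= d) by apply Rmin_l.
assert (He2 : e <= eps / (4 * (K + 1))) by apply Rmin_r.
eapply Rle_trans; [apply H; lra |].
set (m := Rmax (Rabs s) (Rabs u)).
assert (Hsm : Rabs s <= m) by apply Rmax_l.
assert (Hum : Rabs u <= m) by apply Rmax_r.
assert (Hme : m <= e) by (apply Rmax_lub; lra).
pose proof (Rabs_pos s); pose proof (Rabs_pos u).
apply Rle_trans with (K * (2 * m) ^ 2).
- apply Rmult_le_compat_l; [assumption | apply pow_incr; lra].
- replace (K * (2 * m) ^ 2) with (4 * K * m * m) by ring.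
  apply Rmult_le_compat_r; [lra |].
  apply Rle_trans with (4 * (K + 1) * (eps / (4 * (K + 1)))).
  + apply Rmult_le_compat; lra.
  + right; field; lra.
Qed.

(** A matrix of determinant 1 with diagonal (c, c) has characteristic polynomial
   lambda^2 - 2 c lambda + 1. *)
Lemma is_eigenvalue_quadratic (c m12 m21 : R) (lambda : C) :
  m12 <> 0 -> m12 * m21 = c ^ 2 - 1 ->
  (is_eigenvalue c m12 m21 c lambda <->
   (lambda * lambda - 2 * RtoC c * lambda + 1)%C = RtoC 0).
Proof.
intros Hm Hdet.
assert (Hm' : RtoC m12 <> RtoC 0) by (intros E; apply Hm; now apply RtoC_inj).
assert (Hdet' : (RtoC m12 * RtoC m21)%C = (RtoC c * RtoC c - 1)%C).
{ rewrite <- RtoC_mult, Hdet, RtoC_minus; simpl; rewrite !RtoC_mult; ring. }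
split.
- intros (z & w & Hzw & E1 & E2).
  assert (Ew : (RtoC m12 * w = (lambda - RtoC c) * z)%C).
  { transitivity ((RtoC c * z + RtoC m12 * w) - RtoC c * z)%C; [ring |].
    rewrite E1; ring. }
  assert (Hz : z <> RtoC 0).
  { intros Ez; subst z; apply Hzw; f_equal.
    transitivity (/ RtoC m12 * (RtoC m12 * w))%C; [field; assumption |].
    rewrite Ew; ring. }
  assert (E : ((lambda * lambda - 2 * RtoC c * lambda + 1) * z)%C = RtoC 0).
  { transitivity ((lambda - RtoC c) * ((lambda - RtoC c) * z) - (RtoC c * RtoC c - 1) * z)%C;
      [ring |].
    rewrite <- Ew, <- Hdet'.
    transitivity (RtoC m12 * (lambda * w - RtoC m21 * z - RtoC c * w))%C; [ring |].
    rewrite <- E2; ring. }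
  transitivity (/ z * ((lambda * lambda - 2 * RtoC c * lambda + 1) * z))%C;
    [field; assumption | rewrite E; ring].
- intros E; exists (RtoC m12), (lambda - RtoC c)%C; split; [| split].
  + intros H; inversion H; contradiction.
  + ring.
  + transitivity (RtoC m12 * RtoC m21 + RtoC c * (lambda - RtoC c))%C; [ring |].
    rewrite Hdet'.
    transitivity (lambda * (lambda - RtoC c) - (lambda * lambda - 2 * RtoC c * lambda + 1))%C;
      [ring |].
    rewrite E; ring.
Qed.

(** If |c| < 1, the roots are c + i y and c - i y with c^2 + y^2 = 1 and y <> 0;
   their fourth powers are 1 only if c = 0. *)
Lemma eigenvalue_elliptic (c : R) :
  (forall lambda : C, (lambda * lambda - 2 * RtoC c * lambda + 1)%C = RtoC 0 ->
     Cmod lambda = 1 /\ lambda <> RtoC 1 /\ lambda <> RtoC (-1) /\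
     (lambda ^ 4)%C <> RtoC 1) <->
  -1 < c < 1 /\ c <> 0.
Proof.
split.
- intros H.
  assert (Hc1 : c ^ 2 < 1).
  { apply Rnot_le_lt; intros Hc.
    (* A real root of modulus 1 is 1 or -1. *)
    set (l := c + sqrt (c ^ 2 - 1)).
    assert (Hl : l * l - 2 * c * l + 1 = 0).
    { assert (Hs : sqrt (c ^ 2 - 1) * sqrt (c ^ 2 - 1) = c ^ 2 - 1) by (apply sqrt_sqrt; lra).
      unfold l; ring_simplify; rewrite <- Rsqr_pow2 in *; unfold Rsqr in *; lra. }
    destruct (H (RtoC l)) as (H1 & H2 & H3 & _).
    { rewrite <- Hl; unfold RtoC, Cplus, Cminus, Copp, Cmult; simpl; f_equal; ring. }
    rewrite Cmod_R in H1; unfold Rabs in H1; destruct (Rcase_abs l).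
    - apply H3; f_equal; lra.
    - apply H2; f_equal; lra. }
  split; [nra |]; intros ->.
  destruct (H Ci) as (_ & _ & _ & H4).
  { unfold Ci, RtoC, Cplus, Cminus, Copp, Cmult; simpl; f_equal; ring. }
  apply H4; unfold Ci, RtoC; simpl; unfold Cmult; simpl; f_equal; ring.
- intros [Hc Hc0] [x y] E.
  unfold RtoC, Cplus, Cminus, Copp, Cmult in E; simpl in E.
  injection E as E1 E2.
  assert (Hy : y <> 0).
  { intros ->; assert ((x - c) ^ 2 + (1 - c ^ 2) = 0) by (rewrite <- E1; ring).
    pose proof (pow2_ge_0 (x - c)); nra. }
  assert (Hx : x = c).
  { apply Rmult_eq_reg_r with y; [| assumption]; lra. }
  subst x; assert (Hcy : c ^ 2 + y ^ 2 = 1) by lra.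
  split; [| split; [| split]].
  + unfold Cmod; simpl fst; simpl snd; rewrite Hcy; apply sqrt_1.
  + intros H; injection H; intros; contradiction.
  + intros H; injection H; intros; contradiction.
  + intros H; simpl in H; unfold Cmult, RtoC in H; simpl in H.
    injection H as H1 H2.
    assert (H3 : c * y * (c ^ 2 - y ^ 2) = 0) by lra.
    assert (H4 : c ^ 2 = y ^ 2).
    { apply Rmult_integral in H3; destruct H3 as [H3 | H3]; [| lra].
      apply Rmult_integral in H3; tauto. }
    assert (H5 : (c ^ 2) ^ 2 - 6 * c ^ 2 * y ^ 2 + (y ^ 2) ^ 2 = 1) by lra.
    rewrite <- H4 in H5; pose proof (pow2_ge_0 (c ^ 2)); nra.
Qed.

Lemma elliptic_nonresonant_iff (T : R * R -> R * R) (kap c : R) :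
  0 < kap -> T (0, 0) = (0, 0) ->
  Ob 2 (fun s u => fst (T (s, u)) - (c * s + / kap * u)) ->
  Ob 2 (fun s u => snd (T (s, u)) - (kap * (c ^ 2 - 1) * s + c * u)) ->
  (elliptic_nonresonant T <-> -1 < c < 1 /\ c <> 0).
Proof.
intros Hk HT0 H1 H2.
assert (D1 : differentiable_pt_lim (fun s u => fst (T (s, u))) 0 0 c (/ kap)).
{ apply Ob_differentiable; [now rewrite HT0 | exact H1]. }
assert (D2 : differentiable_pt_lim (fun s u => snd (T (s, u))) 0 0 (kap * (c ^ 2 - 1)) c).
{ apply Ob_differentiable; [now rewrite HT0 | exact H2]. }
assert (Hi : / kap <> 0) by (apply Rinv_neq_0_compat; lra).
assert (Hdet : / kap * (kap * (c ^ 2 - 1)) = c ^ 2 - 1) by (field; lra).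
rewrite <- eigenvalue_elliptic; split.
- intros (_ & m11 & m12 & m21 & m22 & D1' & D2' & H) lambda E; apply H.
  apply differentiable_pt_lim_unique in D1; apply differentiable_pt_lim_unique in D1'.
  apply differentiable_pt_lim_unique in D2; apply differentiable_pt_lim_unique in D2'.
  destruct D1 as [A1 A2], D2 as [A3 A4], D1' as [B1 B2], D2' as [B3 B4].
  rewrite A1 in B1; rewrite A2 in B2; rewrite A3 in B3; rewrite A4 in B4.
  subst m11 m12 m21 m22; now apply is_eigenvalue_quadratic.
- intros H; split; [exact HT0 |].
  exists c, (/ kap), (kap * (c ^ 2 - 1)), c; split; [exact D1 | split; [exact D2 |]].
  intros lambda E; apply H; revert E; now apply is_eigenvalue_quadratic.
Qed.

(** * Polynomial symplectic coordinates *)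

(** Polynomial functions of two real variables. *)
Inductive poly2 : (R -> R -> R) -> Prop :=
  | poly2_const (k : R) : poly2 (fun _ _ => k)
  | poly2_fst : poly2 (fun s _ => s)
  | poly2_snd : poly2 (fun _ u => u)
  | poly2_plus (f g : R -> R -> R) :
      poly2 f -> poly2 g -> poly2 (fun s u => f s u + g s u)
  | poly2_mult (f g : R -> R -> R) :
      poly2 f -> poly2 g -> poly2 (fun s u => f s u * g s u).

Lemma poly2_partial (f : R -> R -> R) : poly2 f ->
  exists fs fu : R -> R -> R, poly2 fs /\ poly2 fu /\
    (forall s u, is_derive (fun r : R => f r u) s (fs s u)) /\
    (forall s u, is_derive (fun r : R => f s r) u (fu s u)).
Proof.
induction 1 as [k | | | f g _ (fs & fu & Hfs & Hfu & H1 & H2) _ (gs & gu & Hgs & Hgu & H3 & H4)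
  | f g Hf (fs & fu & Hfs & Hfu & H1 & H2) Hg (gs & gu & Hgs & Hgu & H3 & H4)].
- exists (fun _ _ => 0), (fun _ _ => 0);
    (split; [apply poly2_const | split; [apply poly2_const |]]);
    split; intros; auto_derive; trivial.
- exists (fun _ _ => 1), (fun _ _ => 0);
    (split; [apply poly2_const | split; [apply poly2_const |]]);
    split; intros; auto_derive; trivial.
- exists (fun _ _ => 0), (fun _ _ => 1);
    (split; [apply poly2_const | split; [apply poly2_const |]]);
    split; intros; auto_derive; trivial.
- exists (fun s u => fs s u + gs s u), (fun s u => fu s u + gu s u).
  split; [now apply poly2_plus | split; [now apply poly2_plus | split]]; intros s u.
  + apply (is_derive_plus (fun r => f r u) (fun r => g r u)); auto.
  + apply (is_derive_plus (fun r => f s r) (fun r => g s r)); auto.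
- exists (fun s u => fs s u * g s u + f s u * gs s u),
         (fun s u => fu s u * g s u + f s u * gu s u).
  split; [apply poly2_plus; now apply poly2_mult |].
  split; [apply poly2_plus; now apply poly2_mult | split]; intros s u.
  + apply (is_derive_mult (fun r => f r u) (fun r => g r u)); auto; apply Rmult_comm.
  + apply (is_derive_mult (fun r => f s r) (fun r => g s r)); auto; apply Rmult_comm.
Qed.

Lemma poly2_continuous (f : R -> R -> R) (s u : R) : poly2 f -> continuity_2d_pt f s u.
Proof.
induction 1.
- apply continuity_2d_pt_const.
- apply continuity_2d_pt_id1.
- apply continuity_2d_pt_id2.
- now apply continuity_2d_pt_plus.
- now apply continuity_2d_pt_mult.
Qed.

Lemma poly2_smooth (n : nat) (f : R -> R -> R) (s u : R) : poly2 f -> ex_diff_n f n s u.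
Proof.
revert f s u; induction n as [|n IH]; intros f s u Hf; simpl;
  (split; [now apply poly2_continuous |]); [trivial |].
destruct (poly2_partial f Hf) as (fs & fu & Hfs & Hfu & H1 & H2).
split; [eexists; apply H1 | split; [eexists; apply H2 | split]].
- replace (fun u0 v => Derive (fun z => f z v) u0) with fs; [now apply IH |].
  do 2 (apply functional_extensionality; intro); symmetry; apply is_derive_unique, H1.
- replace (fun u0 v => Derive (fun z => f u0 z) v) with fu; [now apply IH |].
  do 2 (apply functional_extensionality; intro); symmetry; apply is_derive_unique, H2.
Qed.

(** Polynomial area-preserving coordinates (X, Y) which agree with
   (p s + f, u / p + g) up to terms of order 4, f and g being of order 3. *)
Definition polynomial_coordinates (p : R) (X Y f g : R -> R -> R) : Prop :=
  poly2 X /\ poly2 Y /\ X 0 0 = 0 /\ Y 0 0 = 0 /\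
  (forall s u,
    Derive (fun r => X r u) s * Derive (fun r => Y s r) u
    - Derive (fun r => X s r) u * Derive (fun r => Y r u) s = 1) /\
  Ob 3 (fun s u => f s u) /\ Ob 3 (fun s u => g s u) /\
  Ob 4 (fun s u => X s u - (p * s + f s u)) /\
  Ob 4 (fun s u => Y s u - (u / p + g s u)).

Lemma polynomial_coordinates_symplectic (p : R) (X Y f g : R -> R -> R) :
  polynomial_coordinates p X Y f g -> symplectic_coordinates X Y.
Proof.
intros (HX & HY & HX0 & HY0 & HJ & _); repeat split; try assumption.
- apply locally_2d_forall; intros s u n; now apply poly2_smooth.
- apply locally_2d_forall; intros s u n; now apply poly2_smooth.
- now apply locally_2d_forall.
Qed.

Lemma polynomial_coordinates_linear (p : R) : p <> 0 ->
  polynomial_coordinates p (fun s _ => p * s) (fun _ u => u / p)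
    (fun _ _ => 0) (fun _ _ => 0).
Proof.
intros Hp; split; [apply poly2_mult; constructor |].
split; [apply poly2_mult; constructor |].
split; [ring | split; [field; assumption | split]].
- intros s u.
  replace (Derive (fun r => p * r) s) with p
    by (symmetry; apply is_derive_unique; auto_derive; [trivial | ring]).
  replace (Derive (fun r => r / p) u) with (/ p)
    by (symmetry; apply is_derive_unique; auto_derive; [trivial | field; assumption]).
  rewrite !Derive_const; field; assumption.
- assert (H0 : forall n, Ob n (fun _ _ => 0)).
  { intros n; apply (Ob_intro _ _ 0 1); [lra |]; intros; rewrite Rabs_R0; lra. }
  split; [apply H0 | split; [apply H0 | split]]; apply Ob_ext with (2 := H0 4%nat);
    intros; ring.
Qed.

(** The shear (X, Y) -> (X + k q l^3, Y - k r l^3), where l = r X + q Y: the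
   time-one map of the Hamiltonian k l^4 / 4. *)
Lemma polynomial_coordinates_shear (p k r q : R) (X Y f g : R -> R -> R) :
  polynomial_coordinates p X Y f g ->
  polynomial_coordinates p
    (fun s u => X s u + k * q * (r * X s u + q * Y s u) ^ 3)
    (fun s u => Y s u + - k * r * (r * X s u + q * Y s u) ^ 3)
    (fun s u => f s u + k * q * (r * (p * s) + q * (u / p)) ^ 3)
    (fun s u => g s u + - k * r * (r * (p * s) + q * (u / p)) ^ 3).
Proof.
intros (HX & HY & HX0 & HY0 & HJ & Hf & Hg & HXf & HYg).
assert (Hl : poly2 (fun s u => (r * X s u + q * Y s u) ^ 3)).
{ simpl; repeat (assumption || constructor). }
split; [apply poly2_plus; [assumption |]; apply poly2_mult; [constructor | assumption] |].
split; [apply poly2_plus; [assumption |]; apply poly2_mult; [constructor | assumption] |].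
split; [rewrite HX0, HY0; ring |]; split; [rewrite HX0, HY0; ring |]; split.
{ destruct (poly2_partial X HX) as (Xs & Xu & _ & _ & HXs & HXu).
  destruct (poly2_partial Y HY) as (Ys & Yu & _ & _ & HYs & HYu).
  intros s u; specialize (HJ s u).
  rewrite (is_derive_unique _ _ _ (HXs s u)), (is_derive_unique _ _ _ (HXu s u)),
    (is_derive_unique _ _ _ (HYs s u)), (is_derive_unique _ _ _ (HYu s u)) in HJ.
  (* The derivatives of the new coordinates when one variable is fixed. *)
  assert (D : forall (F G : R -> R) (z dF dG m n : R), is_derive F z dF -> is_derive G z dG ->
    is_derive (fun w : R => F w + m * (r * F w + q * G w) ^ 3) z
      (dF + m * (3 * (r * F z + q * G z) ^ 2 * (r * dF + q * dG))) /\
    is_derive (fun w : R => G w + n * (r * F w + q * G w) ^ 3) z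
      (dG + n * (3 * (r * F z + q * G z) ^ 2 * (r * dF + q * dG)))).
  { intros F G z dF dG m n HF HG.
    assert (EF : Derive (fun x => F x) z = dF) by now apply is_derive_unique.
    assert (EG : Derive (fun x => G x) z = dG) by now apply is_derive_unique.
    split; auto_derive; try (repeat split; eexists; eassumption);
      (replace (Derive (fun x => F x) z) with dF by now symmetry);
      (replace (Derive (fun x => G x) z) with dG by now symmetry); ring. }
  destruct (D _ _ _ _ _ (k * q) (- k * r) (HXs s u) (HYs s u)) as [D1 D2].
  destruct (D _ _ _ _ _ (k * q) (- k * r) (HXu s u) (HYu s u)) as [D3 D4].
  rewrite (is_derive_unique _ _ _ D1), (is_derive_unique _ _ _ D2),
    (is_derive_unique _ _ _ D3), (is_derive_unique _ _ _ D4).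
  rewrite <- HJ; ring. }
split; [ob | split; [ob |]].
assert (HX1 : Ob 1 (fun s u => X s u)).
{ apply (Ob_of_diff 1 _ (fun s u => p * s + f s u)); ob. }
assert (HY1 : Ob 1 (fun s u => Y s u)).
{ apply (Ob_of_diff 1 _ (fun s u => u / p + g s u)); ob. }
set (l := fun s u => r * X s u + q * Y s u).
set (l0 := fun s u => r * (p * s) + q * (u / p)).
assert (Hl1 : Ob 1 (fun s u => l s u)) by (unfold l; ob).
assert (Hl01 : Ob 1 (fun s u => l0 s u)) by (unfold l0; ob).
assert (Hd : Ob 3 (fun s u => l s u - l0 s u)).
{ apply Ob_ext with (fun s u => r * (X s u - (p * s + f s u)) + q * (Y s u - (u / p + g s u))
    + r * f s u + q * g s u); [intros; unfold l, l0; ring | ob]. }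
assert (H3 : Ob 4 (fun s u => l s u ^ 3 - l0 s u ^ 3)).
{ apply Ob_ext with (fun s u => (l s u - l0 s u) *
    (l s u ^ 2 + l s u * l0 s u + l0 s u ^ 2)); [intros; ring | ob]. }
split.
- apply Ob_ext with (fun s u => (X s u - (p * s + f s u)) + k * q * (l s u ^ 3 - l0 s u ^ 3));
    [intros; unfold l, l0; ring | ob].
- apply Ob_ext with (fun s u => (Y s u - (u / p + g s u)) + - k * r * (l s u ^ 3 - l0 s u ^ 3));
    [intros; unfold l, l0; ring | ob].
Qed.

(** The quartic Hamiltonian k1 x^3 y + k2 x y^3 is a combination of the fourth
   powers of x + y, x - y, 2 x + y and 2 x - y, so that a composition of four
   shears realizes it to third order. *)
Lemma polynomial_coordinates_exist (p k1 k2 : R) : p <> 0 ->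
  exists X Y : R -> R -> R, polynomial_coordinates p X Y
    (fun s u => k1 * (p * s) ^ 3 + 3 * k2 * (p * s) * (u / p) ^ 2)
    (fun s u => - 3 * k1 * (p * s) ^ 2 * (u / p) - k2 * (u / p) ^ 3).
Proof.
intros Hp.
(* (x + y)^4 - (x - y)^4 = 8 x^3 y + 8 x y^3 and
   (2 x + y)^4 - (2 x - y)^4 = 64 x^3 y + 16 x y^3; the parameter of a shear is four
   times the coefficient of the fourth power. *)
set (mu := (4 * k2 - k1) / 6); set (nu := (k1 - k2) / 12).
assert (H := polynomial_coordinates_linear p Hp).
apply (polynomial_coordinates_shear p mu 1 1) in H.
apply (polynomial_coordinates_shear p (- mu) 1 (-1)) in H.
apply (polynomial_coordinates_shear p nu 2 1) in H.
apply (polynomial_coordinates_shear p (- nu) 2 (-1)) in H.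
match type of H with polynomial_coordinates _ ?X ?Y ?f ?g =>
  exists X, Y;
  assert (Ef : f = fun s u => k1 * (p * s) ^ 3 + 3 * k2 * (p * s) * (u / p) ^ 2);
  [| assert (Eg : g = fun s u => - 3 * k1 * (p * s) ^ 2 * (u / p) - k2 * (u / p) ^ 3)]
end.
- apply functional_extensionality; intros s; apply functional_extensionality; intros u.
  unfold mu, nu; field; assumption.
- apply functional_extensionality; intros s; apply functional_extensionality; intros u.
  unfold mu, nu; field; assumption.
- rewrite Ef, Eg in H; exact H.
Qed.

(** * The first twist coefficient *)

(** The rotation by theta + tau (X^2 + Y^2), to third order. *)
Lemma twist_rotation_expansion (theta tau : R) (X Y : R -> R -> R) :
  Ob 1 (fun s u => X s u) -> Ob 1 (fun s u => Y s u) ->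
  let Theta := fun s u => theta + tau * (X s u ^ 2 + Y s u ^ 2) in
  Ob 4 (fun s u => cos (Theta s u) * X s u - sin (Theta s u) * Y s u -
    (cos theta * X s u - sin theta * Y s u
     - tau * (X s u ^ 2 + Y s u ^ 2) * (sin theta * X s u + cos theta * Y s u))) /\
  Ob 4 (fun s u => sin (Theta s u) * X s u + cos (Theta s u) * Y s u -
    (sin theta * X s u + cos theta * Y s u
     + tau * (X s u ^ 2 + Y s u ^ 2) * (cos theta * X s u - sin theta * Y s u))).
Proof.
intros HX HY Theta.
set (d := fun s u => tau * (X s u ^ 2 + Y s u ^ 2)).
assert (Hd : Ob 2 (fun s u => d s u)) by (unfold d; ob).
assert (Hc : Ob 3 (fun s u => cos (d s u) - 1)).
{ apply (Ob_of_bound 3 _ (fun s u => d s u ^ 2) 1); [| ob].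
  apply locally_2d_forall; intros s u; rewrite <- RPow_abs; apply cos_sub1_bound. }
assert (Hs : Ob 3 (fun s u => sin (d s u) - d s u)).
{ apply (Ob_of_bound 3 _ (fun s u => d s u ^ 3) 1); [| ob].
  apply locally_2d_forall; intros s u; rewrite <- RPow_abs; apply sin_sub_id_bound. }
split.
- apply Ob_ext with (fun s u =>
    (cos (d s u) - 1) * (cos theta * X s u - sin theta * Y s u)
    - (sin (d s u) - d s u) * (sin theta * X s u + cos theta * Y s u)); [| ob].
  intros s u; unfold Theta; fold (d s u); rewrite cos_plus, sin_plus.
  unfold d; ring.
- apply Ob_ext with (fun s u =>
    (cos (d s u) - 1) * (sin theta * X s u + cos theta * Y s u)
    + (sin (d s u) - d s u) * (cos theta * X s u - sin theta * Y s u)); [| ob].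
  intros s u; unfold Theta; fold (d s u); rewrite cos_plus, sin_plus.
  unfold d; ring.
Qed.

(** Substitution of third order expansions into a polynomial of degree 3. *)
Lemma Ob_poly_subst (A B b20 b11 b02 b30 b21 b12 b03 : R) (x y xl yl P Q : R -> R -> R) :
  let h := fun x y => b20 * x ^ 2 + b11 * x * y + b02 * y ^ 2
    + (b30 * x ^ 3 + b21 * x ^ 2 * y + b12 * x * y ^ 2 + b03 * y ^ 3) in
  Ob 1 (fun s u => xl s u) -> Ob 1 (fun s u => yl s u) ->
  Ob 3 (fun s u => P s u) -> Ob 3 (fun s u => Q s u) ->
  Ob 4 (fun s u => x s u - (xl s u + P s u)) ->
  Ob 4 (fun s u => y s u - (yl s u + Q s u)) ->
  Ob 4 (fun s u => (A * x s u + B * y s u + h (x s u) (y s u)) -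
    (A * (xl s u + P s u) + B * (yl s u + Q s u) + h (xl s u) (yl s u))).
Proof.
intros h Hxl Hyl HP HQ Hx Hy.
assert (Hx1 : Ob 1 (fun s u => x s u)) by (apply (Ob_of_diff 1 _ (fun s u => xl s u + P s u)); ob).
assert (Hy1 : Ob 1 (fun s u => y s u)) by (apply (Ob_of_diff 1 _ (fun s u => yl s u + Q s u)); ob).
assert (Hdx : Ob 3 (fun s u => x s u - xl s u)).
{ apply Ob_ext with (fun s u => (x s u - (xl s u + P s u)) + P s u); [intros; ring | ob]. }
assert (Hdy : Ob 3 (fun s u => y s u - yl s u)).
{ apply Ob_ext with (fun s u => (y s u - (yl s u + Q s u)) + Q s u); [intros; ring | ob]. }
apply Ob_ext with (fun s u =>
  A * (x s u - (xl s u + P s u)) + B * (y s u - (yl s u + Q s u))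
  + (x s u - xl s u) * (b20 * (x s u + xl s u) + b11 * y s u
     + b30 * (x s u ^ 2 + x s u * xl s u + xl s u ^ 2)
     + b21 * (x s u + xl s u) * y s u + b12 * y s u ^ 2)
  + (y s u - yl s u) * (b11 * xl s u + b02 * (y s u + yl s u)
     + b21 * xl s u ^ 2 + b12 * xl s u * (y s u + yl s u)
     + b03 * (y s u ^ 2 + y s u * yl s u + yl s u ^ 2))); [intros; unfold h; ring | ob].
Qed.

Lemma scal_small_zero (x M d : R) :
  0 < d -> (forall h, 0 < h < d -> Rabs x <= M * h) -> x = 0.
Proof.
intros Hd H; destruct (Req_dec x 0) as [| Hx]; [assumption | exfalso].
pose proof (Rabs_pos_lt x Hx) as Hp.
assert (HM : 0 < Rabs M + 1) by (pose proof (Rabs_pos M); lra).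
assert (Hq : 0 < Rabs x / (2 * (Rabs M + 1))) by (apply Rdiv_lt_0_compat; lra).
set (h := Rmin (d / 2) (Rabs x / (2 * (Rabs M + 1)))).
assert (Hh : 0 < h) by (apply Rmin_glb_lt; lra).
assert (Hh1 : h <= d / 2) by apply Rmin_l.
assert (Hh2 : h <= Rabs x / (2 * (Rabs M + 1))) by apply Rmin_r.
specialize (H h ltac:(lra)).
assert (M * h <= (Rabs M + 1) * (Rabs x / (2 * (Rabs M + 1)))).
{ apply Rle_trans with ((Rabs M + 1) * h).
  - apply Rmult_le_compat_r; [lra | pose proof (Rle_abs M); lra].
  - apply Rmult_le_compat_l; lra. }
replace ((Rabs M + 1) * (Rabs x / (2 * (Rabs M + 1)))) with (Rabs x / 2) in H0 by (field; lra).
lra.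
Qed.

Lemma cubic_small_zero (a b c K d : R) : 0 < d <= 1 -> 0 <= K ->
  (forall h, 0 < h < d -> Rabs (h * a + h ^ 2 * b + h ^ 3 * c) <= K * h ^ 4) ->
  a = 0 /\ b = 0 /\ c = 0.
Proof.
intros Hd HK H.
assert (Hdiv : forall h x y, 0 < h -> Rabs (h * x) <= h * y -> Rabs x <= y).
{ intros h x y Hh; rewrite Rabs_mult, (Rabs_pos_eq h) by lra; intros Hm.
  now apply Rmult_le_reg_l with h. }
assert (H1 : forall h, 0 < h < d -> Rabs (a + h * (b + h * c)) <= K * h ^ 3).
{ intros h Hh; apply (Hdiv h); [lra |].
  replace (h * (a + h * (b + h * c))) with (h * a + h ^ 2 * b + h ^ 3 * c) by ring.
  replace (h * (K * h ^ 3)) with (K * h ^ 4) by ring; auto. }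
assert (Hp3 : forall h, 0 < h < d -> K * h ^ 3 <= K * h ^ 2 /\ K * h ^ 2 <= K * h).
{ intros h Hh; split; apply Rmult_le_compat_l; try assumption; simpl; nra. }
assert (Ha : a = 0).
{ apply (scal_small_zero a (K + Rabs b + Rabs c) d); [lra |]; intros h Hh.
  specialize (H1 h Hh); specialize (Hp3 h Hh).
  replace a with ((a + h * (b + h * c)) - h * (b + h * c)) by ring.
  eapply Rle_trans; [apply Rabs_triang |]; rewrite Rabs_Ropp, Rabs_mult, (Rabs_pos_eq h) by lra.
  assert (Rabs (b + h * c) <= Rabs b + Rabs c).
  { eapply Rle_trans; [apply Rabs_triang |]; rewrite Rabs_mult, (Rabs_pos_eq h) by lra.
    pose proof (Rabs_pos c); nra. }
  nra. }
subst a.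
assert (H2 : forall h, 0 < h < d -> Rabs (b + h * c) <= K * h ^ 2).
{ intros h Hh; apply (Hdiv h); [lra |].
  replace (h * (b + h * c)) with (0 + h * (b + h * c)) by ring.
  replace (h * (K * h ^ 2)) with (K * h ^ 3) by ring; auto. }
assert (Hb : b = 0).
{ apply (scal_small_zero b (K + Rabs c) d); [lra |]; intros h Hh.
  specialize (H2 h Hh); specialize (Hp3 h Hh).
  replace b with ((b + h * c) - h * c) by ring.
  eapply Rle_trans; [apply Rabs_triang |]; rewrite Rabs_Ropp, Rabs_mult, (Rabs_pos_eq h) by lra.
  nra. }
subst b; repeat split.
apply (scal_small_zero c K d); [lra |]; intros h Hh; apply (Hdiv h); [lra |].
replace (h * c) with (0 + h * c) by ring.
replace (h * (K * h)) with (K * h ^ 2) by ring; auto.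
Qed.

(** Homogeneous parts of degrees 1, 2, 3 are determined modulo order 4; the quadratic
   part vanishes as well, but only the other two are needed. *)
Lemma Ob4_homogeneous (f1 f2 f3 : R -> R -> R) :
  (forall h s u, f1 (h * s) (h * u) = h * f1 s u) ->
  (forall h s u, f2 (h * s) (h * u) = h ^ 2 * f2 s u) ->
  (forall h s u, f3 (h * s) (h * u) = h ^ 3 * f3 s u) ->
  Ob 4 (fun s u => f1 s u + f2 s u + f3 s u) ->
  forall s u, f1 s u = 0 /\ f3 s u = 0.
Proof.
intros E1 E2 E3 HO s u; destruct (Ob_elim _ _ HO) as (K & d & HK & Hd & H).
pose proof (sum_abs_ge0 s u) as Hr; set (r := Rabs s + Rabs u) in *.
assert (Hdr : 0 < d / (r + 1) <= 1).
{ pose proof (cond_pos d); split; [apply Rdiv_lt_0_compat; lra |].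
  apply Rle_div_l; lra. }
destruct (cubic_small_zero (f1 s u) (f2 s u) (f3 s u) (K * r ^ 4) (d / (r + 1)))
  as (H1 & _ & H3); [assumption | | | split; assumption].
- apply Rmult_le_pos; [assumption | now apply pow_le].
- intros h [Hh Hhd].
  rewrite <- E1, <- E2, <- E3.
  replace (K * r ^ 4 * h ^ 4) with (K * (Rabs (h * s) + Rabs (h * u)) ^ 4).
  2:{ rewrite !Rabs_mult, (Rabs_pos_eq h) by lra; unfold r; ring. }
  assert (Hb : h * r < d).
  { apply Rle_lt_trans with (h * (r + 1)); [nra |]; apply Rlt_div_r; lra. }
  apply H; rewrite Rabs_mult, (Rabs_pos_eq h) by lra;
    apply Rle_lt_trans with (2 := Hb); apply Rmult_le_compat_l; unfold r; try lra;
    pose proof (Rabs_pos s); pose proof (Rabs_pos u); lra.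
Qed.

(** The Taylor expansion to third order, in the scaled variables p s and u / p. *)
Lemma smooth_taylor3 (X : R -> R -> R) (p : R) : p <> 0 ->
  smooth_near_origin X -> X 0 0 = 0 ->
  exists b20 b11 b02 b30 b21 b12 b03 : R,
    Ob 4 (fun s u => X s u -
      (Derive (fun r => X r 0) 0 / p * (p * s) + Derive (fun r => X 0 r) 0 * p * (u / p) +
       (b20 * (p * s) ^ 2 + b11 * (p * s) * (u / p) + b02 * (u / p) ^ 2
        + (b30 * (p * s) ^ 3 + b21 * (p * s) ^ 2 * (u / p)
           + b12 * (p * s) * (u / p) ^ 2 + b03 * (u / p) ^ 3)))).
Proof.
intros Hp HX HX0.
destruct (Taylor_Lagrange_2d X 3 0 0) as [D HD].
{ revert HX; apply locally_2d_impl, locally_2d_forall; auto. }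
set (co := fun i j => Binomial.C (i + j) i * partial_derive i j X 0 0 /
  INR (Factorial.fact (i + j)) * p ^ j / p ^ i).
exists (co 2%nat 0%nat), (co 1%nat 1%nat), (co 0%nat 2%nat),
  (co 3%nat 0%nat), (co 2%nat 1%nat), (co 1%nat 2%nat), (co 0%nat 3%nat).
apply (Ob_of_bound 4 _ (fun s u => (Rabs s + Rabs u) ^ 4) (Rmax D 0)).
2:{ apply (Ob_intro _ _ 1 1); [lra |]; intros s u _ _.
    rewrite (Rabs_pos_eq ((Rabs s + Rabs u) ^ 4)) by (apply pow_le, sum_abs_ge0); lra. }
revert HD; apply locally_2d_impl, locally_2d_forall; intros s u H.
rewrite !Rminus_0_r in H.
match type of H with Rabs ?l <= _ => match goal with |- Rabs ?r <= _ => replace r with l end end.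
- eapply Rle_trans; [exact H |].
  apply Rle_trans with (Rmax D 0 * Rmax (Rabs s) (Rabs u) ^ 4).
  + apply Rmult_le_compat_r; [| apply Rmax_l].
    apply pow_le; apply Rle_trans with (Rabs s); [apply Rabs_pos | apply Rmax_l].
  + apply Rmult_le_compat_l; [apply Rmax_r |].
    rewrite (Rabs_pos_eq ((Rabs s + Rabs u) ^ 4)) by (apply pow_le, sum_abs_ge0).
    pose proof (Rabs_pos s); pose proof (Rabs_pos u).
    apply pow_incr; split;
      [apply Rle_trans with (Rabs s); [assumption | apply Rmax_l] | apply Rmax_lub; lra].
- unfold DL_pol, differential; cbn [sum_f_R0 Nat.sub].
  unfold co; cbn [Nat.add].
  replace (partial_derive 0 0 X 0 0) with 0 by (symmetry; exact HX0).
  replace (partial_derive 1 0 X 0 0) with (Derive (fun r => X r 0) 0) by reflexivity.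
  replace (partial_derive 0 1 X 0 0) with (Derive (fun r => X 0 r) 0) by reflexivity.
  replace (Binomial.C 1 0) with 1 by (unfold Binomial.C; simpl; field).
  replace (Binomial.C 1 1) with 1 by (unfold Binomial.C; simpl; field).
  assert (Hf : forall n, INR (Factorial.fact n) <> 0) by (intros; apply INR_fact_neq_0).
  replace (INR (Factorial.fact 1)) with 1 by (simpl; ring).
  replace (INR (Factorial.fact 0)) with 1 by (simpl; ring).
  pose proof (Hf 2%nat); pose proof (Hf 3%nat).
  generalize dependent (INR (Factorial.fact 2)); generalize dependent (INR (Factorial.fact 3)).
  intros; field; auto.
Qed.

(** Terms of order 4 in (s, u) are of order 4 in coordinates (X, Y) whose linear part
   is (p s, u / p). *)
Lemma coordinates_lower_bound (p : R) (X Y : R -> R -> R) : 0 < p ->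
  Ob 2 (fun s u => X s u - p * s) -> Ob 2 (fun s u => Y s u - u / p) ->
  exists M : R, locally_2d (fun s u =>
    (Rabs s + Rabs u) ^ 4 <= M * (X s u ^ 2 + Y s u ^ 2) ^ 2) 0 0.
Proof.
intros Hp HX HY.
destruct (Ob_elim _ _ HX) as (K & d & HK & _ & H).
destruct (Ob_elim _ _ HY) as (K' & d' & HK' & _ & H').
set (c := / p + p).
assert (Hip : 0 < / p) by now apply Rinv_0_lt_compat.
assert (Hc : 0 < c) by (unfold c; lra).
set (e := / (4 * (c * (K + K' + 1)))).
assert (He : 0 < e) by (apply Rinv_0_lt_compat; nra).
assert (Hmin : 0 < Rmin e (Rmin d d')).
{ repeat apply Rmin_glb_lt; try apply cond_pos; assumption. }
exists ((8 * c ^ 2) ^ 2), (mkposreal _ Hmin); simpl pos; intros s u.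
rewrite !Rminus_0_r; intros Hs Hu.
pose proof (Rmin_l e (Rmin d d')); pose proof (Rmin_r e (Rmin d d')).
pose proof (Rmin_l d d'); pose proof (Rmin_r d d').
specialize (H s u ltac:(lra) ltac:(lra)); specialize (H' s u ltac:(lra) ltac:(lra)).
pose proof (sum_abs_ge0 s u) as Hr; set (r := Rabs s + Rabs u) in *.
assert (Hre : c * (K + K' + 1) * r <= / 2).
{ apply Rle_trans with (c * (K + K' + 1) * (2 * e)).
  - apply Rmult_le_compat_l; [nra | unfold r; lra].
  - right; unfold e; field; split; lra. }
assert (Hrs : r <= c * (Rabs (p * s) + Rabs (u / p))).
{ unfold Rdiv; rewrite !Rabs_mult, (Rabs_pos_eq p), (Rabs_pos_eq (/ p)) by lra.
  unfold c, r.
  replace ((/ p + p) * (p * Rabs s + Rabs u * / p)) with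
    (Rabs s + Rabs u + (p * p * Rabs s + / p * / p * Rabs u)) by (field; lra).
  assert (0 <= p * p * Rabs s) by (apply Rmult_le_pos; [nra | apply Rabs_pos]).
  assert (0 <= / p * / p * Rabs u) by (apply Rmult_le_pos; [nra | apply Rabs_pos]).
  lra. }
assert (HA : Rabs (p * s) <= Rabs (X s u) + K * r ^ 2).
{ replace (p * s) with (X s u - (X s u - p * s)) by ring.
  eapply Rle_trans; [apply Rabs_triang |]; rewrite Rabs_Ropp; lra. }
assert (HB : Rabs (u / p) <= Rabs (Y s u) + K' * r ^ 2).
{ replace (u / p) with (Y s u - (Y s u - u / p)) by ring.
  eapply Rle_trans; [apply Rabs_triang |]; rewrite Rabs_Ropp; lra. }
assert (Hr2 : r <= 2 * c * (Rabs (X s u) + Rabs (Y s u))).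
{ assert (c * (K + K') * r ^ 2 <= / 2 * r).
  { replace (c * (K + K') * r ^ 2) with (c * (K + K') * r * r) by ring.
    apply Rmult_le_compat_r; [assumption |].
    apply Rle_trans with (2 := Hre); apply Rmult_le_compat_r; [assumption |].
    apply Rmult_le_compat_l; lra. }
  assert (r <= c * (Rabs (X s u) + K * r ^ 2 + (Rabs (Y s u) + K' * r ^ 2))).
  { apply Rle_trans with (1 := Hrs), Rmult_le_compat_l; lra. }
  nra. }
replace ((8 * c ^ 2) ^ 2 * (X s u ^ 2 + Y s u ^ 2) ^ 2)
  with ((8 * c ^ 2 * (X s u ^ 2 + Y s u ^ 2)) ^ 2) by ring.
replace (r ^ 4) with ((r ^ 2) ^ 2) by ring.
apply pow_incr; split; [apply pow2_ge_0 |].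
apply Rle_trans with ((2 * c * (Rabs (X s u) + Rabs (Y s u))) ^ 2); [apply pow_incr; lra |].
rewrite <- (pow2_abs (X s u)), <- (pow2_abs (Y s u)).
pose proof (pow2_ge_0 (c * (Rabs (X s u) - Rabs (Y s u)))); nra.
Qed.

(** Here (P, Q) is the cubic part of the map in the variables x = p s, y = u / p, and
   (X3, Y3) is the Hamiltonian field of k1 x^3 y + k2 x y^3.  The last two hypotheses
   are the cubic part of the conjugacy equation. *)
Lemma twist_coefficient_exists (T : R * R -> R * R) (p theta tau k1 k2 : R)
    (P Q : R -> R -> R) :
  let c := cos theta in
  let S := sin theta in
  let X3 := fun x y => k1 * x ^ 3 + 3 * k2 * x * y ^ 2 in
  let Y3 := fun x y => - 3 * k1 * x ^ 2 * y - k2 * y ^ 3 in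
  0 < p -> elliptic_nonresonant T ->
  Ob 3 (fun s u => P (p * s) (u / p)) -> Ob 3 (fun s u => Q (p * s) (u / p)) ->
  Ob 4 (fun s u => p * fst (T (s, u)) -
    (c * (p * s) - S * (u / p) + P (p * s) (u / p))) ->
  Ob 4 (fun s u => snd (T (s, u)) / p -
    (S * (p * s) + c * (u / p) + Q (p * s) (u / p))) ->
  (forall x y, P x y + X3 (c * x - S * y) (S * x + c * y) =
    c * X3 x y - S * Y3 x y - tau * (x ^ 2 + y ^ 2) * (S * x + c * y)) ->
  (forall x y, Q x y + Y3 (c * x - S * y) (S * x + c * y) =
    S * X3 x y + c * Y3 x y + tau * (x ^ 2 + y ^ 2) * (c * x - S * y)) ->
  is_first_twist_coefficient T tau.
Proof.
intros c S X3 Y3 Hp Hell HP HQ HTx HTy Ex Ey; split; [exact Hell |].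
destruct (polynomial_coordinates_exist p k1 k2 ltac:(lra)) as (X & Y & HXY).
exists X, Y, theta; split; [exact (polynomial_coordinates_symplectic _ _ _ _ _ HXY) |].
destruct HXY as (_ & _ & _ & _ & _ & _ & _ & HX & HY).
assert (HX1 : Ob 1 (fun s u => X s u)).
{ apply (Ob_of_diff 1 _ (fun s u =>
    p * s + (k1 * (p * s) ^ 3 + 3 * k2 * (p * s) * (u / p) ^ 2))); ob. }
assert (HY1 : Ob 1 (fun s u => Y s u)).
{ apply (Ob_of_diff 1 _ (fun s u =>
    u / p + (- 3 * k1 * (p * s) ^ 2 * (u / p) - k2 * (u / p) ^ 3))); ob. }
assert (HXd : Ob 3 (fun s u => X s u - p * s)).
{ apply Ob_ext with (fun s u =>
    (X s u - (p * s + (k1 * (p * s) ^ 3 + 3 * k2 * (p * s) * (u / p) ^ 2)))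
    + (k1 * (p * s) ^ 3 + 3 * k2 * (p * s) * (u / p) ^ 2)); [intros; ring | ob]. }
assert (HYd : Ob 3 (fun s u => Y s u - u / p)).
{ apply Ob_ext with (fun s u =>
    (Y s u - (u / p + (- 3 * k1 * (p * s) ^ 2 * (u / p) - k2 * (u / p) ^ 3)))
    + (- 3 * k1 * (p * s) ^ 2 * (u / p) - k2 * (u / p) ^ 3)); [intros; ring | ob]. }
destruct (coordinates_lower_bound p X Y Hp) as [M HM];
  [now apply (Ob_le 2 3); [lia |] | now apply (Ob_le 2 3); [lia |] |].
assert (Hxl : Ob 1 (fun s u => c * (p * s) - S * (u / p))) by ob.
assert (Hyl : Ob 1 (fun s u => S * (p * s) + c * (u / p))) by ob.
assert (HT1 : Ob 1 (fun s u => fst (T (s, u)))).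
{ apply Ob_ext with (fun s u => / p * (p * fst (T (s, u)))); [intros; field; lra |].
  apply Ob_scal.
  apply (Ob_of_diff 1 _ (fun s u => c * (p * s) - S * (u / p) + P (p * s) (u / p))); ob. }
assert (HT2 : Ob 1 (fun s u => snd (T (s, u)))).
{ apply Ob_ext with (fun s u => p * (snd (T (s, u)) / p)); [intros; field; lra |].
  apply Ob_scal.
  apply (Ob_of_diff 1 _ (fun s u => S * (p * s) + c * (u / p) + Q (p * s) (u / p))); ob. }
assert (HXT := Ob_comp _ _ _ _ HX HT1 HT2).
assert (HYT := Ob_comp _ _ _ _ HY HT1 HT2).
cbv beta in HXT, HYT.
assert (HXs := Ob_poly_subst 1 0 0 0 0 k1 0 (3 * k2) 0 _ _ _ _ _ _ Hxl Hyl HP HQ HTx HTy).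
assert (HYs := Ob_poly_subst 0 1 0 0 0 0 (- 3 * k1) 0 (- k2) _ _ _ _ _ _ Hxl Hyl HP HQ HTx HTy).
cbv beta in HXs, HYs.
destruct (twist_rotation_expansion theta tau X Y HX1 HY1) as [HRx HRy].
fold c S in HRx, HRy.
(* The cubic term of the rotation only sees the linear parts of X and Y. *)
assert (Hcub : forall m n, Ob 4 (fun s u =>
  tau * (X s u ^ 2 + Y s u ^ 2) * (m * X s u + n * Y s u) -
  tau * ((p * s) ^ 2 + (u / p) ^ 2) * (m * (p * s) + n * (u / p)))).
{ intros m n; apply Ob_ext with (fun s u =>
    tau * ((X s u - p * s) * (X s u + p * s) + (Y s u - u / p) * (Y s u + u / p))
      * (m * X s u + n * Y s u)
    + tau * ((p * s) ^ 2 + (u / p) ^ 2) * (m * (X s u - p * s) + n * (Y s u - u / p)));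
    [intros; ring | ob]. }
assert (Hcx := Hcub S c); assert (Hcy := Hcub c (- S)).
assert (HFx : Ob 4 (fun s u => X (fst (T (s, u))) (snd (T (s, u))) -
  (cos (theta + tau * (X s u ^ 2 + Y s u ^ 2)) * X s u
   - sin (theta + tau * (X s u ^ 2 + Y s u ^ 2)) * Y s u))).
{ eapply Ob_ext; [| exact (Ob_plus _ _ _ (Ob_minus _ _ _ (Ob_plus _ _ _ (Ob_plus _ _ _ HXT HXs)
     (Ob_scal _ (- c) _ HX)) HRx) (Ob_plus _ _ _ (Ob_scal _ S _ HY) Hcx))].
  intros s u; cbv beta; specialize (Ex (p * s) (u / p)); unfold X3, Y3 in Ex.
  unfold Rminus in *; lra. }
assert (HFy : Ob 4 (fun s u => Y (fst (T (s, u))) (snd (T (s, u))) -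
  (sin (theta + tau * (X s u ^ 2 + Y s u ^ 2)) * X s u
   + cos (theta + tau * (X s u ^ 2 + Y s u ^ 2)) * Y s u))).
{ eapply Ob_ext; [| exact (Ob_minus _ _ _ (Ob_minus _ _ _ (Ob_plus _ _ _ (Ob_plus _ _ _ HYT HYs)
     (Ob_scal _ (- S) _ HX)) HRy) (Ob_plus _ _ _ (Ob_scal _ c _ HY) Hcy))].
  intros s u; cbv beta; specialize (Ey (p * s) (u / p)); unfold X3, Y3 in Ey.
  unfold Rminus in *; lra. }
destruct (Ob_elim _ _ HFx) as (K & d & HK & _ & HKx).
destruct (Ob_elim _ _ HFy) as (K' & d' & HK' & _ & HKy).
exists ((K + K') * M).
assert (HL : locally_2d (fun s u => Rabs s < d /\ Rabs u < d /\ Rabs s < d' /\ Rabs u < d') 0 0).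
{ assert (Hmin : 0 < Rmin d d') by (apply Rmin_glb_lt; apply cond_pos).
  exists (mkposreal _ Hmin); simpl; intros s u; rewrite !Rminus_0_r; intros Hs Hu.
  pose proof (Rmin_l d d'); pose proof (Rmin_r d d'); repeat split; lra. }
generalize (locally_2d_and _ _ _ _ HL HM).
apply locally_2d_impl, locally_2d_forall; intros s u [(H1 & H2 & H3 & H4) H5].
specialize (HKx s u H1 H2); specialize (HKy s u H3 H4).
destruct (T (s, u)) as [s1 u1]; cbn [fst snd] in HKx, HKy.
assert (H6 : 0 <= (Rabs s + Rabs u) ^ 4) by (apply pow_le, sum_abs_ge0).
assert (H7 : (K + K') * (Rabs s + Rabs u) ^ 4 <= (K + K') * M * (X s u ^ 2 + Y s u ^ 2) ^ 2).
{ rewrite Rmult_assoc; apply Rmult_le_compat_l; lra. }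
split; nra.
Qed.

(** The binary cubic form with the given coefficients. *)
Definition cubic_form (a30 a21 a12 a03 x y : R) : R :=
  a30 * x ^ 3 + a21 * x ^ 2 * y + a12 * x * y ^ 2 + a03 * y ^ 3.

(** A linear map of determinant 1 which conjugates two rotations of angle not a
   multiple of pi is a rotation, and the angles agree. *)
Lemma rotation_conjugacy (A B E F c S C D : R) :
  A * F - B * E = 1 -> c ^ 2 + S ^ 2 = 1 -> C ^ 2 + D ^ 2 = 1 -> S <> 0 ->
  (forall x y, A * (c * x - S * y) + B * (S * x + c * y) =
     C * (A * x + B * y) - D * (E * x + F * y)) ->
  (forall x y, E * (c * x - S * y) + F * (S * x + c * y) =
     D * (A * x + B * y) + C * (E * x + F * y)) ->
  C = c /\ D = S /\ E = - B /\ F = A.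
Proof.
intros Hdet HcS HCD HS H1 H2.
assert (E1 := H1 1 0); assert (E2 := H1 0 1).
assert (E3 := H2 1 0); assert (E4 := H2 0 1).
ring_simplify in E1; ring_simplify in E2; ring_simplify in E3; ring_simplify in E4.
assert (HC : C = c).
{ assert (H : 2 * C * (A * F - B * E) = 2 * c * (A * F - B * E)).
  { transitivity (F * (C * A - D * E) - E * (C * B - D * F)
      - B * (D * A + C * E) + A * (D * B + C * F)); [ring |].
    transitivity (F * (A * c + B * S) - E * (- (A * S) + B * c)
      - B * (E * c + F * S) + A * (- (E * S) + F * c)); [| ring].
    f_equal; [f_equal; [f_equal |] |]; f_equal; lra. }
  rewrite Hdet in H; lra. }
subst C; split; [reflexivity |].
assert (F1 : B * S = - (D * E)) by lra.
assert (F2 : A * S = D * F) by lra.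
assert (F3 : F * S = D * A) by lra.
assert (F4 : E * S = - (D * B)) by lra.
assert (HD : (D - S) * (D + S) = 0) by nra.
destruct (Rmult_integral _ _ HD) as [H | H].
- assert (D = S) by lra; subst D; split; [reflexivity |].
  split; apply Rmult_eq_reg_r with S; lra.
- exfalso; assert (D = - S) by lra; subst D.
  assert (E = B) by (apply Rmult_eq_reg_r with S; lra).
  assert (F = - A) by (apply Rmult_eq_reg_r with S; lra).
  subst E F; nra.
Qed.

(** The hypotheses are the cubic part of the equation conjugating the map of linear
   part c + i S and cubic part (P, Q) to the twist normal form, by coordinates of
   linear part z -> (A - i B) z, z = x + i y, and cubic part (M, N).  Comparing the
   coefficients of z^2 conj(z), those of (M, N) cancel as |c + i S| = 1, and there
   remains (pr + i qi) / 8 = i (c + i S) tau, where pr and qi are the two left-hand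
   sides of the conclusion. *)
Lemma resonant_coefficient (A B c S tau P30 P21 P12 P03 Q30 Q21 Q12 Q03
    m30 m21 m12 m03 n30 n21 n12 n03 : R) :
  A ^ 2 + B ^ 2 = 1 -> c ^ 2 + S ^ 2 = 1 ->
  let M := cubic_form m30 m21 m12 m03 in
  let N := cubic_form n30 n21 n12 n03 in
  let P := cubic_form P30 P21 P12 P03 in
  let Q := cubic_form Q30 Q21 Q12 Q03 in
  (forall x y, A * P x y + B * Q x y + M (c * x - S * y) (S * x + c * y) =
     c * M x y - S * N x y - tau * ((A * x + B * y) ^ 2 + (- B * x + A * y) ^ 2) *
       (S * (A * x + B * y) + c * (- B * x + A * y))) ->
  (forall x y, - B * P x y + A * Q x y + N (c * x - S * y) (S * x + c * y) =
     S * M x y + c * N x y + tau * ((A * x + B * y) ^ 2 + (- B * x + A * y) ^ 2) *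
       (c * (A * x + B * y) - S * (- B * x + A * y))) ->
  3 * P30 + P12 + Q21 + 3 * Q03 = - 8 * S * tau /\
  3 * Q30 + Q12 - P21 - 3 * P03 = 8 * c * tau.
Proof.
intros HAB HcS M N P Q H1 H2.
set (f := fun x y => A * P x y + B * Q x y + M (c * x - S * y) (S * x + c * y) -
  (c * M x y - S * N x y - tau * ((A * x + B * y) ^ 2 + (- B * x + A * y) ^ 2) *
       (S * (A * x + B * y) + c * (- B * x + A * y)))).
set (g := fun x y => - B * P x y + A * Q x y + N (c * x - S * y) (S * x + c * y) -
  (S * M x y + c * N x y + tau * ((A * x + B * y) ^ 2 + (- B * x + A * y) ^ 2) *
       (c * (A * x + B * y) - S * (- B * x + A * y)))).
assert (Hf : forall x y, f x y = 0) by (intros; unfold f; rewrite H1; ring).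
assert (Hg : forall x y, g x y = 0) by (intros; unfold g; rewrite H2; ring).
assert (HS2 : S ^ 2 = 1 - c ^ 2) by lra.
assert (HB2 : B ^ 2 = 1 - A ^ 2) by lra.
set (pr := 3 * P30 + P12 + Q21 + 3 * Q03).
set (qi := 3 * Q30 + Q12 - P21 - 3 * P03).
(* The right-hand sides are 8 times the real and the imaginary part of the coefficient
   of z^2 conj(z) in f + i g, expressed through values of f and g. *)
assert (L1 : A * pr + B * qi + 8 * tau * (S * A - c * B) =
  3 * f 1 0 + ((f 1 1 + f 1 (-1)) / 2 - f 1 0)
  + ((g 1 1 - g 1 (-1)) / 2 - g 0 1) + 3 * g 0 1).
{ unfold f, g, M, N, P, Q, cubic_form, pr, qi; field [HS2 HB2]. }
assert (L2 : A * qi - B * pr - 8 * tau * (c * A + S * B) =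
  3 * g 1 0 + ((g 1 1 + g 1 (-1)) / 2 - g 1 0)
  - ((f 1 1 - f 1 (-1)) / 2 - f 0 1) - 3 * f 0 1).
{ unfold f, g, M, N, P, Q, cubic_form, pr, qi; field [HS2 HB2]. }
rewrite !Hf, !Hg in L1, L2.
assert (L1' : A * pr + B * qi = - (8 * tau * (S * A - c * B))) by lra.
assert (L2' : A * qi - B * pr = 8 * tau * (c * A + S * B)) by lra.
split.
- transitivity ((A ^ 2 + B ^ 2) * pr); [rewrite HAB; ring |].
  transitivity (A * (A * pr + B * qi) - B * (A * qi - B * pr)); [ring |].
  rewrite L1', L2'.
  transitivity (- 8 * S * tau * (A ^ 2 + B ^ 2)); [ring | rewrite HAB; ring].
- transitivity ((A ^ 2 + B ^ 2) * qi); [rewrite HAB; ring |].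
  transitivity (B * (A * pr + B * qi) + A * (A * qi - B * pr)); [ring |].
  rewrite L1', L2'.
  transitivity (8 * c * tau * (A ^ 2 + B ^ 2)); [ring | rewrite HAB; ring].
Qed.

(** The twist coefficient of any normal form is determined by the coefficient of
   z^2 conj(z), z = x + i y, in the cubic part (P, Q) of the map. *)
Lemma twist_coefficient_unique (T : R * R -> R * R) (p c S tau
    P30 P21 P12 P03 Q30 Q21 Q12 Q03 : R) :
  let P := cubic_form P30 P21 P12 P03 in
  let Q := cubic_form Q30 Q21 Q12 Q03 in
  0 < p -> c ^ 2 + S ^ 2 = 1 -> S <> 0 ->
  Ob 4 (fun s u => p * fst (T (s, u)) -
    (c * (p * s) - S * (u / p) + P (p * s) (u / p))) ->
  Ob 4 (fun s u => snd (T (s, u)) / p -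
    (S * (p * s) + c * (u / p) + Q (p * s) (u / p))) ->
  is_first_twist_coefficient T tau ->
  3 * P30 + P12 + Q21 + 3 * Q03 = - 8 * S * tau /\
  3 * Q30 + Q12 - P21 - 3 * P03 = 8 * c * tau.
Proof.
intros P Q Hp HcS HS HTx HTy (_ & X & Y & theta & (HX0 & HY0 & HXs & HYs & HJ) & K & HK).
destruct (smooth_taylor3 X p ltac:(lra) HXs HX0) as (a20 & a11 & a02 & a30 & a21 & a12 & a03 & HX).
destruct (smooth_taylor3 Y p ltac:(lra) HYs HY0) as (b20 & b11 & b02 & b30 & b21 & b12 & b03 & HY).
apply locally_2d_singleton in HJ.
set (A := Derive (fun r => X r 0) 0 / p) in *; set (B := Derive (fun r => X 0 r) 0 * p) in *.
set (E := Derive (fun r => Y r 0) 0 / p) in *; set (F := Derive (fun r => Y 0 r) 0 * p) in *.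
assert (Hdet : A * F - B * E = 1).
{ rewrite <- HJ; unfold A, B, E, F; field; lra. }
clear HJ; clearbody A B E F.
set (M2 := fun x y => a20 * x ^ 2 + a11 * x * y + a02 * y ^ 2).
set (N2 := fun x y => b20 * x ^ 2 + b11 * x * y + b02 * y ^ 2).
set (M := cubic_form a30 a21 a12 a03); set (N := cubic_form b30 b21 b12 b03).
change (Ob 4 (fun s u => X s u - (A * (p * s) + B * (u / p) +
  (M2 (p * s) (u / p) + M (p * s) (u / p))))) in HX.
change (Ob 4 (fun s u => Y s u - (E * (p * s) + F * (u / p) +
  (N2 (p * s) (u / p) + N (p * s) (u / p))))) in HY.
assert (HP : Ob 3 (fun s u => P (p * s) (u / p))) by (unfold P, cubic_form; ob).
assert (HQ : Ob 3 (fun s u => Q (p * s) (u / p))) by (unfold Q, cubic_form; ob).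
assert (HM : Ob 3 (fun s u => M (p * s) (u / p))) by (unfold M, cubic_form; ob).
assert (HN : Ob 3 (fun s u => N (p * s) (u / p))) by (unfold N, cubic_form; ob).
assert (HM2 : Ob 2 (fun s u => M2 (p * s) (u / p))) by (unfold M2; ob).
assert (HN2 : Ob 2 (fun s u => N2 (p * s) (u / p))) by (unfold N2; ob).
assert (Hxl : Ob 1 (fun s u => c * (p * s) - S * (u / p))) by ob.
assert (Hyl : Ob 1 (fun s u => S * (p * s) + c * (u / p))) by ob.
assert (HT1 : Ob 1 (fun s u => fst (T (s, u)))).
{ apply Ob_ext with (fun s u => / p * (p * fst (T (s, u)))); [intros; field; lra
    |].
  apply Ob_scal.
  apply (Ob_of_diff 1 _ (fun s u => c * (p * s) - S * (u / p) + P (p * s) (u / p))); ob. }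
assert (HT2 : Ob 1 (fun s u => snd (T (s, u)))).
{ apply Ob_ext with (fun s u => p * (snd (T (s, u)) / p)); [intros; field; lra
    |].
  apply Ob_scal.
  apply (Ob_of_diff 1 _ (fun s u => S * (p * s) + c * (u / p) + Q (p * s) (u / p))); ob. }
assert (HXT := Ob_comp _ _ _ _ HX HT1 HT2).
assert (HYT := Ob_comp _ _ _ _ HY HT1 HT2).
cbv beta in HXT, HYT.
assert (HXp := Ob_poly_subst A B a20 a11 a02 a30 a21 a12 a03 _ _ _ _ _ _ Hxl Hyl HP HQ HTx HTy).
assert (HYp := Ob_poly_subst E F b20 b11 b02 b30 b21 b12 b03 _ _ _ _ _ _ Hxl Hyl HP HQ HTx HTy).
cbv beta in HXp, HYp.
assert (HX1 : Ob 1 (fun s u => X s u)).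
{ apply (Ob_of_diff 1 _ (fun s u => A * (p * s) + B * (u / p) +
    (M2 (p * s) (u / p) + M (p * s) (u / p)))); ob. }
assert (HY1 : Ob 1 (fun s u => Y s u)).
{ apply (Ob_of_diff 1 _ (fun s u => E * (p * s) + F * (u / p) +
    (N2 (p * s) (u / p) + N (p * s) (u / p)))); ob. }
set (X1 := fun x y => A * x + B * y); set (Y1 := fun x y => E * x + F * y).
assert (HX1O : Ob 1 (fun s u => X1 (p * s) (u / p))) by (unfold X1; ob).
assert (HY1O : Ob 1 (fun s u => Y1 (p * s) (u / p))) by (unfold Y1; ob).
assert (HXd : Ob 2 (fun s u => X s u - X1 (p * s) (u / p))).
{ apply Ob_ext with (fun s u => (X s u - (A * (p * s) + B * (u / p) +
    (M2 (p * s) (u / p) + M (p * s) (u / p)))) + (M2 (p * s) (u / p) + M (p * s) (u / p)));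
  [intros; unfold X1; ring | ob]. }
assert (HYd : Ob 2 (fun s u => Y s u - Y1 (p * s) (u / p))).
{ apply Ob_ext with (fun s u => (Y s u - (E * (p * s) + F * (u / p) +
    (N2 (p * s) (u / p) + N (p * s) (u / p)))) + (N2 (p * s) (u / p) + N (p * s) (u / p)));
  [intros; unfold Y1; ring | ob]. }
destruct (twist_rotation_expansion theta tau X Y HX1 HY1) as [HRx HRy].
set (C := cos theta) in *; set (D := sin theta) in *.
assert (HCD : C ^ 2 + D ^ 2 = 1).
{ pose proof (sin2_cos2 theta) as Hsc; unfold Rsqr in Hsc; unfold C, D; lra. }
assert (Hcub : forall m n, Ob 4 (fun s u =>
  tau * (X s u ^ 2 + Y s u ^ 2) * (m * X s u + n * Y s u) -
  tau * (X1 (p * s) (u / p) ^ 2 + Y1 (p * s) (u / p) ^ 2) *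
    (m * X1 (p * s) (u / p) + n * Y1 (p * s) (u / p)))).
{ intros m n; apply Ob_ext with (fun s u =>
    tau * ((X s u - X1 (p * s) (u / p)) * (X s u + X1 (p * s) (u / p))
         + (Y s u - Y1 (p * s) (u / p)) * (Y s u + Y1 (p * s) (u / p)))
      * (m * X s u + n * Y s u)
    + tau * (X1 (p * s) (u / p) ^ 2 + Y1 (p * s) (u / p) ^ 2) *
      (m * (X s u - X1 (p * s) (u / p)) + n * (Y s u - Y1 (p * s) (u / p))));
    [intros; ring | ob]. }
assert (Hcx := Hcub D C); assert (Hcy := Hcub C (- D)).
assert (Hr4 : Ob 4 (fun s u => (X s u ^ 2 + Y s u ^ 2) ^ 2)) by ob.
assert (HFx : Ob 4 (fun s u => X (fst (T (s, u))) (snd (T (s, u))) -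
  (cos (theta + tau * (X s u ^ 2 + Y s u ^ 2)) * X s u
   - sin (theta + tau * (X s u ^ 2 + Y s u ^ 2)) * Y s u))).
{ apply (Ob_of_bound 4 _ (fun s u => (X s u ^ 2 + Y s u ^ 2) ^ 2) K); [| exact Hr4].
  revert HK; apply locally_2d_impl, locally_2d_forall; intros s u.
  destruct (T (s, u)) as [s1 u1]; cbn [fst snd]; intros [H _].
  now rewrite (Rabs_pos_eq ((X s u ^ 2 + Y s u ^ 2) ^ 2)) by apply pow2_ge_0. }
assert (HFy : Ob 4 (fun s u => Y (fst (T (s, u))) (snd (T (s, u))) -
  (sin (theta + tau * (X s u ^ 2 + Y s u ^ 2)) * X s u
   + cos (theta + tau * (X s u ^ 2 + Y s u ^ 2)) * Y s u))).
{ apply (Ob_of_bound 4 _ (fun s u => (X s u ^ 2 + Y s u ^ 2) ^ 2) K); [| exact Hr4].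
  revert HK; apply locally_2d_impl, locally_2d_forall; intros s u.
  destruct (T (s, u)) as [s1 u1]; cbn [fst snd]; intros [_ H].
  now rewrite (Rabs_pos_eq ((X s u ^ 2 + Y s u ^ 2) ^ 2)) by apply pow2_ge_0. }
(* The homogeneous parts of the conjugacy equation. *)
set (f1 := fun x y => X1 (c * x - S * y) (S * x + c * y) - (C * X1 x y - D * Y1 x y)).
set (f2 := fun x y => M2 (c * x - S * y) (S * x + c * y) - (C * M2 x y - D * N2 x y)).
set (f3 := fun x y => A * P x y + B * Q x y + M (c * x - S * y) (S * x + c * y) -
  (C * M x y - D * N x y - tau * (X1 x y ^ 2 + Y1 x y ^ 2) * (D * X1 x y + C * Y1 x y))).
set (g1 := fun x y => Y1 (c * x - S * y) (S * x + c * y) - (D * X1 x y + C * Y1 x y)).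
set (g2 := fun x y => N2 (c * x - S * y) (S * x + c * y) - (D * M2 x y + C * N2 x y)).
set (g3 := fun x y => E * P x y + F * Q x y + N (c * x - S * y) (S * x + c * y) -
  (D * M x y + C * N x y + tau * (X1 x y ^ 2 + Y1 x y ^ 2) * (C * X1 x y - D * Y1 x y))).
assert (Hf : Ob 4 (fun s u => f1 (p * s) (u / p) + f2 (p * s) (u / p) + f3 (p * s) (u / p))).
{ eapply Ob_ext; [| exact (Ob_minus _ _ _ (Ob_minus _ _ _ (Ob_plus _ _ _ (Ob_plus _ _ _ HFx HRx)
    (Ob_minus _ _ _ (Ob_scal _ C _ HX) (Ob_scal _ D _ HY))) (Ob_plus _ _ _ HXT HXp)) Hcx)].
  intros s u; cbv beta; unfold f1, f2, f3, M2, M, N2, N, cubic_form, X1, Y1; ring. }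
assert (Hg : Ob 4 (fun s u => g1 (p * s) (u / p) + g2 (p * s) (u / p) + g3 (p * s) (u / p))).
{ eapply Ob_ext; [| exact (Ob_plus _ _ _ (Ob_minus _ _ _ (Ob_plus _ _ _ (Ob_plus _ _ _ HFy HRy)
    (Ob_plus _ _ _ (Ob_scal _ D _ HX) (Ob_scal _ C _ HY))) (Ob_plus _ _ _ HYT HYp)) Hcy)].
  intros s u; cbv beta; unfold g1, g2, g3, M2, M, N2, N, cubic_form, X1, Y1; ring. }
assert (Hf0 : forall x y, f1 x y = 0 /\ f3 x y = 0).
{ intros x y.
  destruct (Ob4_homogeneous (fun s u => f1 (p * s) (u / p)) (fun s u => f2 (p * s) (u / p))
    (fun s u => f3 (p * s) (u / p))) with (s := x / p) (u := p * y) as [Ha Hb];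
    [intros h s u; unfold f1, X1, Y1; field; lra
    | intros h s u; unfold f2, M2, N2; field; lra
    | intros h s u; unfold f3, X1, Y1, M, N, P, Q, cubic_form; field; lra
    | exact Hf |].
  replace (p * (x / p)) with x in * by (field; lra).
  replace (p * y / p) with y in * by (field; lra); auto. }
assert (Hg0 : forall x y, g1 x y = 0 /\ g3 x y = 0).
{ intros x y.
  destruct (Ob4_homogeneous (fun s u => g1 (p * s) (u / p)) (fun s u => g2 (p * s) (u / p))
    (fun s u => g3 (p * s) (u / p))) with (s := x / p) (u := p * y) as [Ha Hb];
    [intros h s u; unfold g1, X1, Y1; field; lra
    | intros h s u; unfold g2, M2, N2; field; lra
    | intros h s u; unfold g3, X1, Y1, M, N, P, Q, cubic_form; field; lra
    | exact Hg |].
  replace (p * (x / p)) with x in * by (field; lra).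
  replace (p * y / p) with y in * by (field; lra); auto. }
destruct (rotation_conjugacy A B E F c S C D) as (EC & ED & EE & EF); try assumption.
{ intros x y; destruct (Hf0 x y) as [H _]; unfold f1, X1, Y1 in H; lra. }
{ intros x y; destruct (Hg0 x y) as [H _]; unfold g1, X1, Y1 in H; lra. }
apply (resonant_coefficient A B c S tau P30 P21 P12 P03 Q30 Q21 Q12 Q03
    a30 a21 a12 a03 b30 b21 b12 b03); try assumption.
- rewrite EE, EF in Hdet; lra.
- intros x y; destruct (Hf0 x y) as [_ H]; unfold f3, X1, Y1 in H.
  rewrite EC, ED, EE, EF in H; apply Rminus_diag_uniq; exact H.
- intros x y; destruct (Hg0 x y) as [_ H]; unfold g3, X1, Y1 in H.
  rewrite EC, ED, EE, EF in H; apply Rminus_diag_uniq; exact H.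
Qed.

(** * The twist coefficient of the billiard map *)

(** In the scaled coordinates this is - 4 times the mean over phi of the quartic form
   at (cos phi, cos (phi + theta)), where c = cos theta. *)
Lemma generating_map_twist (T : R * R -> R * R) (kap c e1 e2 e3 : R) :
  0 < kap -> -1 < c < 1 -> c <> 0 -> elliptic_nonresonant T ->
  Ob 4 (fun s u => fst (T (s, u)) -
    (c * s + u / kap - quartic_d1 e1 e2 e3 s (c * s + u / kap) / kap)) ->
  Ob 4 (fun s u => snd (T (s, u)) -
    (kap * (c * (c * s + u / kap) - s)
     - c * quartic_d1 e1 e2 e3 s (c * s + u / kap)
     - quartic_d1 e1 e2 e3 (c * s + u / kap) s)) ->
  forall tau, is_first_twist_coefficient T tau <->
    tau = - (3 * e1 + 3 * c * e2 + (/ 2 + c ^ 2) * e3) / ((1 - c ^ 2) * kap ^ 2).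
Proof.
intros Hk Hc Hc0 Hell H1 H2 tau.
assert (Hc2 : 0 < 1 - c ^ 2) by nra.
set (theta := - acos c); set (S := sin theta).
assert (Hcos : cos theta = c).
{ unfold theta; rewrite cos_neg; apply cos_acos; lra. }
assert (HSv : S = - sqrt (1 - c ^ 2)).
{ unfold S, theta; rewrite sin_neg, sin_acos by lra; unfold Rsqr; f_equal; f_equal; ring. }
assert (HS2 : S ^ 2 = 1 - c ^ 2).
{ rewrite HSv; replace ((- sqrt (1 - c ^ 2)) ^ 2) with (sqrt (1 - c ^ 2) ^ 2) by ring.
  apply pow2_sqrt; lra. }
assert (HSneg : S < 0) by (rewrite HSv; pose proof (sqrt_lt_R0 _ Hc2); lra).
(* For p^2 = - kap sin theta the linear part in the coordinates x = p s, y = u / p is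
   the rotation by theta; this requires sin theta < 0, as orientation is preserved. *)
set (p := sqrt (- S * kap)).
assert (HSk : 0 < - S * kap) by (apply Rmult_lt_0_compat; lra).
assert (Hp : 0 < p) by now apply sqrt_lt_R0.
assert (Hp2 : p ^ 2 = - S * kap) by (apply pow2_sqrt; lra).
assert (Hkap : kap = - p ^ 2 / S) by (rewrite Hp2; field; lra).
(* The quartic form in the scaled coordinates, and the cubic part (P, Q) of the map. *)
set (E1 := e1 / p ^ 4); set (E2 := e2 / p ^ 4); set (E3 := e3 / p ^ 4).
set (P := fun x y => S * quartic_d1 E1 E2 E3 x (c * x - S * y)).
set (Q := fun x y => - c * quartic_d1 E1 E2 E3 x (c * x - S * y)
   - quartic_d1 E1 E2 E3 (c * x - S * y) x).
assert (Htau : - (3 * e1 + 3 * c * e2 + (/ 2 + c ^ 2) * e3) / ((1 - c ^ 2) * kap ^ 2) =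
  - (3 * E1 + 3 * c * E2 + (/ 2 + c ^ 2) * E3)).
{ rewrite <- HS2; unfold E1, E2, E3; rewrite Hkap; field; split; lra. }
assert (HTx : Ob 4 (fun s u => p * fst (T (s, u)) -
    (c * (p * s) - S * (u / p) + P (p * s) (u / p)))).
{ apply Ob_ext with (2 := Ob_scal _ p _ H1); intros s u.
  unfold P, E1, E2, E3, quartic_d1; rewrite Hkap; field; lra. }
assert (HTy : Ob 4 (fun s u => snd (T (s, u)) / p -
    (S * (p * s) + c * (u / p) + Q (p * s) (u / p)))).
{ apply Ob_ext with (2 := Ob_div _ p _ H2); intros s u.
  unfold Q, E1, E2, E3, quartic_d1; rewrite Hkap; field [HS2]; lra. }
rewrite Htau; split.
- intros Htw.
  assert (HG1 : forall x y, quartic_d1 E1 E2 E3 x (c * x - S * y) =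
    cubic_form (4 * E1 + E2 * (3 * c + c ^ 3) + 2 * E3 * c ^ 2)
      (- 3 * E2 * S * (1 + c ^ 2) - 4 * E3 * c * S)
      (3 * E2 * c * S ^ 2 + 2 * E3 * S ^ 2) (- E2 * S ^ 3) x y).
  { intros; unfold quartic_d1, cubic_form; ring. }
  assert (HG2 : forall x y, quartic_d1 E1 E2 E3 (c * x - S * y) x =
    cubic_form (4 * E1 * c ^ 3 + E2 * (3 * c ^ 2 + 1) + 2 * E3 * c)
      (- 12 * E1 * c ^ 2 * S - 6 * E2 * c * S - 2 * E3 * S)
      (12 * E1 * c * S ^ 2 + 3 * E2 * S ^ 2) (- 4 * E1 * S ^ 3) x y).
  { intros; unfold quartic_d1, cubic_form; ring. }
  unfold P, Q in HTx, HTy.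
  destruct (twist_coefficient_unique T p c S tau
    (S * (4 * E1 + E2 * (3 * c + c ^ 3) + 2 * E3 * c ^ 2))
    (S * (- 3 * E2 * S * (1 + c ^ 2) - 4 * E3 * c * S))
    (S * (3 * E2 * c * S ^ 2 + 2 * E3 * S ^ 2))
    (S * (- E2 * S ^ 3))
    (- c * (4 * E1 + E2 * (3 * c + c ^ 3) + 2 * E3 * c ^ 2)
      - (4 * E1 * c ^ 3 + E2 * (3 * c ^ 2 + 1) + 2 * E3 * c))
    (- c * (- 3 * E2 * S * (1 + c ^ 2) - 4 * E3 * c * S)
      - (- 12 * E1 * c ^ 2 * S - 6 * E2 * c * S - 2 * E3 * S))
    (- c * (3 * E2 * c * S ^ 2 + 2 * E3 * S ^ 2)
      - (12 * E1 * c * S ^ 2 + 3 * E2 * S ^ 2))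
    (- c * (- E2 * S ^ 3) - (- 4 * E1 * S ^ 3))) as [Hre Him];
    [exact Hp | lra | lra | | | exact Htw |].
  + apply Ob_ext with (2 := HTx); intros s u.
    rewrite HG1; unfold cubic_form; ring.
  + apply Ob_ext with (2 := HTy); intros s u.
    rewrite HG1, HG2; unfold cubic_form; ring.
  + assert (H8 : 8 * tau = c * (8 * c * tau) - S * (- 8 * S * tau)) by ring [HS2].
    rewrite <- Hre, <- Him in H8.
    apply Rmult_eq_reg_l with 8; [| lra].
    rewrite H8; field [HS2].
- intros Et.
  (* At (x, y) = (cos phi, sin phi), with psi = phi + theta / 2, the quartic form is
     h0 + h2 cos (2 psi) + h4 cos (4 psi), since x = cos (psi - theta / 2) and
     c x - S y = cos (psi + theta / 2).  It is compensated by the Hamiltonian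
     - h2 / (2 sin theta) sin (2 phi) - h4 / (2 sin (2 theta)) sin (4 phi). *)
  set (h2 := E1 * c + E2 * (1 + c ^ 2) / 2 + E3 * c / 2).
  set (h4 := E1 * (2 * c ^ 2 - 1) / 4 + E2 * c / 4 + E3 / 8).
  apply (twist_coefficient_exists T p theta tau (- (h2 + h4 / c) / S) (- (h2 - h4 / c) / S) P Q);
    try assumption.
  + unfold P, quartic_d1; ob.
  + unfold Q, quartic_d1; ob.
  + now rewrite Hcos.
  + now rewrite Hcos.
  + intros x y; rewrite Hcos; fold S; rewrite Et; unfold P, h2, h4, quartic_d1.
    field [HS2]; split; lra.
  + intros x y; rewrite Hcos; fold S; rewrite Et; unfold Q, h2, h4, quartic_d1.
    field [HS2]; split; lra.
Qed.

Theorem theorem4p1 :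
  forall (a b L eps delta : R) (c : nat -> R) (N : nat) (t : R -> R)
         (T : R * R -> R * R) (Rc Rc'' : R),
    let F := minkowski a b in
    let alpha := even_poly c N in
    let g0 := fun s => gamma0 alpha (t s) in
    let g1 := fun s => gamma1 L alpha (t s) in
    0 < a -> a <= 1 -> a + b = 1 ->
    0 < L -> 0 < eps -> 0 < delta -> (1 <= N)%nat -> 0 < c 1%nat ->
    is_arclength_parameter F eps delta (gamma0 alpha) t ->
    is_arclength_parameter F eps delta (gamma1 L alpha) t ->
    is_one_step_billiard_map F delta g0 g1 T ->
    Rc = radius_of_curvature g0 0 ->
    Rc'' = Derive_n (radius_of_curvature g0) 2 0 ->
    (elliptic_nonresonant T <-> (0 < L < 2 * a * Rc /\ L <> a * Rc)) /\
    (0 < L < 2 * a * Rc -> L <> a * Rc ->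
     forall tau : R,
       is_first_twist_coefficient T tau <->
       tau = (a ^ 2 * L * Rc * Rc'' + (4 - 3 * a) * a * L
              + 2 * (2 * a - 9) * a * Rc + 12 * Rc)
             / (8 * a ^ 2 * Rc * (L - 2 * a * Rc))).
Proof.
intros a b L eps delta c N t T Rc Rc'' F alpha g0 g1 Ha0 Ha1 Hab HL Heps Hdelta HN Hc1
  Ht0' _ HT HRc HRc''.
destruct (even_poly_derivatives c N HN)
  as (c4 & q0 & q1 & q2 & q3 & d1 & d2 & d3 & Hq & Ea & E1 & E2 & E3 & D1 & D2 & D3).
fold alpha in Ea, D1; set (c1 := c 1%nat) in *.
assert (Ha : 0 <= a) by lra; assert (Hb : 0 <= b) by lra.
assert (Ht := arclength_derive a b eps delta alpha d1 t Ha Hb Hab D1 Ht0').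
destruct Ht0' as [Ht0 _].
destruct (Hq 0) as (Hq00 & Hq10 & _ & _).
destruct (arclength_expansion a b delta c1 c4 alpha d1 q0 q1 t Ha Hb Hab Hdelta)
  as (X1 & X2 & X3 & X4); try assumption;
  try (apply (ex_derive_continuous (V := R_NormedModule)); assumption).
set (k := 2 * a * c1 ^ 2 / 3) in *.
assert (Hphase := phase_expansion a b L c1 c4 k alpha d1 t Ha Hb Hab HL eq_refl X1 X2 X3 X4).
assert (Hal : Ob 2 (fun s _ => alpha (t s))).
{ apply (Ob_of_diff 2 _ (fun s _ => c1 * s ^ 2)); ob. }
assert (Hmap := billiard_phase a b L delta alpha d1 t T HL D1 Ht Hal HT).
destruct HT as (HT0 & HTc & _).
(* R(0) = 1 / (2 c1) and R''(0) = 6 c1 - 6 c4 / c1^2. *)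
set (G := fun s => - / speed a b (d1 (t s))).
assert (Hsp : forall s, 1 <= speed a b (d1 (t s))) by (intros; now apply speed_ge1).
assert (HGneg : forall s, G s < 0).
{ intros s; unfold G; specialize (Hsp s).
  assert (0 < / speed a b (d1 (t s))) by (apply Rinv_0_lt_compat; lra); lra. }
assert (HGd : forall s, Rabs s < delta -> ex_derive G s).
{ intros s Hs; apply (ex_derive_comp (fun x => - / speed a b (d1 x)) t);
    [| eexists; now apply Ht].
  specialize (Hsp s); unfold speed, root4 in Hsp |- *.
  pose proof (pow2_ge_0 (d1 (t s))); pose proof (pow4_ge0 (d1 (t s))).
  auto_derive.
  assert (P2 : d1 (t s) * (d1 (t s) * 1) = d1 (t s) ^ 2) by ring.
  assert (P4 : d1 (t s) * (d1 (t s) * (d1 (t s) * (d1 (t s) * 1))) = d1 (t s) ^ 4) by ring.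
  rewrite P4, !P2.
  repeat split; try (eexists; apply D2); try apply sqrt_lt_R0; lra. }
destruct (radius_of_curvature_second_derivative alpha d1 d2 d3 t G delta c1 c4)
  as [HR HR'']; try assumption.
{ apply is_derive_ext with (fun x => 24 * c4 * x + x ^ 3 * q3 x); [intros; now rewrite E3 |].
  auto_derive; [apply Hq | ring]. }
{ unfold G; rewrite Ht0, E1; unfold speed, root4.
  replace (1 + (2 * c1 * 0 + 4 * c4 * 0 ^ 3 + 0 ^ 5 * q1 0) ^ 2) with 1 by ring.
  replace (1 + (2 * c1 * 0 + 4 * c4 * 0 ^ 3 + 0 ^ 5 * q1 0) ^ 4) with 1 by ring.
  rewrite !sqrt_1, !Rmult_1_r, Hab; field. }
{ rewrite E1; ring. }
{ rewrite E2; ring. }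
{ rewrite E3; ring. }
fold g0 in HR, HR''; rewrite HR in HRc; rewrite HR'' in HRc''.
clear HR HR'' HGd HGneg Hsp.
(* The linear part of the phase coordinate is kap (v - cc s), and cc = L / (a R) - 1. *)
set (kap := a / L); set (cc := 2 * c1 * L / a - 1).
assert (Hkap : 0 < kap) by (apply Rdiv_lt_0_compat; lra).
set (e1 := 2 * c1 * k - c4 + a * c1 / (2 * L ^ 2) - a * k / L + (2 * b - a) / (8 * L ^ 3)) in *.
set (e2 := a * c1 / L ^ 2 - a * k / L + (2 * b - a) / (2 * L ^ 3)) in *.
set (e3 := a * c1 / L ^ 2 + 3 * (2 * b - a) / (4 * L ^ 3)) in *.
destruct (implicit_map_expansion (phase a b L alpha d1 t) kap cc e1 e2 e3 T Hkap HT0 HTc)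
  as [HT1 HT2]; [| exact Hmap |].
{ apply Ob_ext with (2 := Hphase); intros s v; unfold kap, cc; field; lra. }
assert (Hell : elliptic_nonresonant T <-> -1 < cc < 1 /\ cc <> 0).
{ apply (elliptic_nonresonant_iff T kap cc Hkap HT0).
  - apply Ob_ext with (fun s u => (fst (T (s, u)) -
      (cc * s + u / kap - quartic_d1 e1 e2 e3 s (cc * s + u / kap) / kap))
      - quartic_d1 e1 e2 e3 s (cc * s + u / kap) / kap);
      [intros; field; lra | unfold quartic_d1 in *; ob].
  - apply Ob_ext with (fun s u => (snd (T (s, u)) -
      (kap * (cc * (cc * s + u / kap) - s) - cc * quartic_d1 e1 e2 e3 s (cc * s + u / kap)
        - quartic_d1 e1 e2 e3 (cc * s + u / kap) s))
      - (cc * quartic_d1 e1 e2 e3 s (cc * s + u / kap)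
        + quartic_d1 e1 e2 e3 (cc * s + u / kap) s));
      [intros; field; lra | unfold quartic_d1 in *; ob]. }
assert (Hcc : -1 < cc < 1 /\ cc <> 0 <-> 0 < L < 2 * a * Rc /\ L <> a * Rc).
{ assert (HRpos : 0 < Rc) by (rewrite HRc; apply Rinv_0_lt_compat; lra).
  assert (Ecc : cc = (L - a * Rc) / (a * Rc)) by (unfold cc; rewrite HRc; field; lra).
  assert (HaR : 0 < a * Rc) by (apply Rmult_lt_0_compat; lra).
  assert (Ecc' : cc * (a * Rc) = L - a * Rc) by (rewrite Ecc; field; lra).
  split; intros [H1 H2]; split.
  - split; [assumption | nra].
  - intros H; apply H2; apply Rmult_eq_reg_r with (a * Rc); lra.
  - split; apply Rmult_lt_reg_r with (a * Rc); lra.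
  - intros H; apply H2; rewrite H in Ecc'; lra. }
split; [rewrite Hell; exact Hcc |].
intros HLR HLn tau.
assert (Hc := proj2 Hcc (conj HLR HLn)); assert (He := proj2 Hell Hc).
rewrite (generating_map_twist T kap cc e1 e2 e3 Hkap (proj1 Hc) (proj2 Hc) He HT1 HT2 tau).
match goal with |- _ = ?x <-> _ = ?y => replace x with y; [reflexivity |] end.
assert (Hne : a - c1 * L <> 0).
{ intros H; destruct Hc as [[_ Hc] _]; unfold cc in Hc.
  replace (2 * c1 * L / a) with 2 in Hc; [lra |].
  replace (2 * c1 * L) with (2 * a) by lra; field; lra. }
rewrite HRc, HRc''; unfold e1, e2, e3, k, kap, cc.
replace b with (1 - a) by lra.
field.
repeat split; try lra.
replace (a ^ 2 - (2 * c1 * L - a) ^ 2) with (4 * (c1 * L) * (a - c1 * L)) by ring.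
apply Rmult_integral_contrapositive_currified; [| assumption].
assert (0 < c1 * L) by (apply Rmult_lt_0_compat; assumption); lra.
Qed.
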